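(* Let $R$, $I$, $(F_\bullet,d_\bullet)$, $F_1'$, $e_0^1,\dots,e_0^t$, $\mathfrak a_i$, $(G^i_\bullet,m^i_\bullet)$, $q_1^i,q_2^i$ and the iterated trimming complex $(T_\bullet,\ell_\bullet)$ be as in the context, with $F_\bullet$ and all $G^i_\bullet$ length $3$ DG-algebras. Assume moreover that $G_\bullet^i$ admits the structure of a DG-module over each $G_\bullet^j$ for all $1\le i,j\le t$. Then the following products can be extended to a DG-algebra structure on $T_\bullet$ (here $f_1\in F_1'$, $g_1^i\in G_1^i$, $g_2^i\in G_2^i$, and $1\le i,j,k\le t$): (1) $F_1'\otimes G_1^i\to F_2\oplus\bigoplus_{j}G_2^j$: $$f_1\cdot_Tg_1^i:=m_1^i(g_1^i)\,e_0^i\cdot_Ff_1+\sum_{j=1}^tg_1^i\cdot_{G^j}q_1^j(e_0^i\cdot_Ff_1).$$ (2) $G_1^i\otimes G_1^j\to F_2\oplus\bigoplus_kG_2^k$ for $i<j$: $$g_1^i\cdot_Tg_1^j:=m_1^i(g_1^i)m_1^j(g_1^j)\,e_0^i\cdot_Fe_0^j+\sum_{k=1}^tg_2^k,$$ where $$g_2^k=\begin{cases}m_1^j(g_1^j)\,g_1^i\cdot_{G^i}q_1^i(e_0^i\cdot_Fe_0^j)&k=i,\\ m_1^i(g_1^i)\,g_1^j\cdot_{G^j}q_1^j(e_0^i\cdot_Fe_0^j)&k=j,\\ m_1^i(g_1^i)\,g_1^j\cdot_{G^k}q_1^k(e_0^i\cdot_Fe_0^j)&\text{otherwise.}\end{cases}$$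 (3) $F_1'\otimes G_2^i\to F_3\oplus\bigoplus_jG_3^j$: $$f_1\cdot_Tg_2^i:=-\sum_{j=1}^tg_2^i\cdot_{G^j}q_1^j(e_0^i\cdot_Ff_1).$$ (4) $G_1^i\otimes G_2^j\to F_3\oplus\bigoplus_kG_3^k$ for $i\neq j$: $$g_1^i\cdot_Tg_2^j:=\begin{cases}-\sum_{k\ne i}m_1^i(g_1^i)\,g_2^j\cdot_{G^k}q_1^k(e_0^i\cdot_Fe_0^j)&i<j,\\ -m_1^i(g_1^i)\,g_2^j\cdot_{G^j}q_1^j(e_0^i\cdot_Fe_0^j)&j<i.\end{cases}$$
   Context: A DG-algebra over a commutative Noetherian ring $R$ is a complex of finitely generated free $R$-modules $(F_\bullet,d_\bullet)$ with a unitary associative multiplication satisfying $F_i\cdot F_j\subseteq F_{i+j}$, $d(f_if_j)=d(f_i)f_j+(-1)^if_id(f_j)$, $f_if_j=(-1)^{ij}f_jf_i$, and $f_i^2=0$ for $i$ odd (where $f_i\in F_i$). The product of a DG-algebra $F_\bullet$ is written $\cdot_F$. Setting. $(R,\mathfrak m,k)$ is a regular local ring (alternatively, a standard graded polynomial ring over a field $k$ with all data homogeneous). $I\subseteq R$ is an ideal and $(F_\bullet,d_\bullet)$ is a free resolution of $R/I$ with $F_0=R$ (not necessarily minimal). Write $F_1=F_1'\oplus\bigoplus_{i=1}^tRe_0^i$, where each $e_0^i$ generates a free direct summand, and decompose $d_2=d_2'+d_0^1+\dots+d_0^t$ with $d_2'\in\operatorname{Hom}_R(F_2,F_1')$ and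 $d_0^i\in\operatorname{Hom}_R(F_2,Re_0^i)$. For each $i$ let $\mathfrak a_i$ be an ideal with $d_0^i(F_2)\subseteq\mathfrak a_ie_0^i$ and $(G^i_\bullet,m^i_\bullet)$ a free resolution of $R/\mathfrak a_i$ with $G_0^i=R$. All of $F_\bullet,G^i_\bullet$ have length $3$. Let $q_1^i:F_2\to G_1^i$ and $q_2^i:F_3\to G_2^i$ be maps with $m_1^i(q_1^i(f_2))\,e_0^i=d_0^i(f_2)$ and $m_2^i\circ q_2^i=q_1^i\circ d_3$ (such maps exist). The iterated trimming complex $T_\bullet$ is the complex with $T_0=R$, $T_1=F_1'\oplus\bigoplus_iG_1^i$, $T_2=F_2\oplus\bigoplus_iG_2^i$, $T_3=F_3\oplus\bigoplus_iG_3^i$ (elements of direct sums are written as sums) and differentials $\ell_1(f_1+\sum g_1^i)=d_1(f_1)-\sum_i m_1^i(g_1^i)d_1(e_0^i)$, $\ell_2(f_2+\sum g_2^i)=d_2'(f_2)-\sum_iq_1^i(f_2)+\sum_im_2^i(g_2^i)$, $\ell_3(f_3+\sum g_3^i)=d_3(f_3)+\sum_iq_2^i(f_3)+\sum_im_3^i(g_3^i)$. It is known that $T_\bullet$ is a free resolution of $R/J$, where $J=d_1(F_1')+\sum_i\mathfrak a_i\,d_1(e_0^i)$. Notation for the module actions: for $x\in G^i_a$ and $y\in G^j_b$, the symbol $x\cdot_{G^j}y\in G^j_{a+b}$ denotes the action of $x\in G^i_\bullet$ on $y$ in the DG-$G^i_\bullet$-module $G^j_\bullet$; for $i=j$ this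 is the multiplication of $G^i_\bullet$. *)

(* Defs.v *)
From HB Require Import structures.
From mathcomp Require Import all_boot all_order all_algebra.
From mathcomp Require Import mpoly.

Set Implicit Arguments.
Unset Strict Implicit.
Unset Printing Implicit Defensive.

Import GRing.Theory.
Local Open Scope ring_scope.

(* Regular local rings.  Ideals are Prop-valued: the ideals of ring_quotient  *)
(* are proper and decidable, whereas the unit ideal has to be allowed here.   *)

Section RegularLocal.
Variable R : comNzRingType.
Implicit Types I P M : R -> Prop.

Definition is_ideal I :=
  [/\ I 0, forall x y, I x -> I y -> I (x + y) & forall a x, I x -> I (a * x)].

Definition generated_by n (s : 'I_n -> R) I :=
  forall x, I x <-> exists c : 'I_n -> R, x = \sum_i c i * s i.

Definition is_noetherian :=
  forall I, is_ideal I -> exists n (s : 'I_n -> R), generated_by s I.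

Definition is_prime_ideal P :=
  [/\ is_ideal P, ~ P 1 & forall x y, P (x * y) -> P x \/ P y].

Definition is_maximal_ideal M :=
  [/\ is_ideal M, ~ M 1 &
      forall I, is_ideal I -> (forall x, M x -> I x) -> ~ I 1 ->
      forall x, I x -> M x].

Definition is_local_with M :=
  is_maximal_ideal M /\
  forall M', is_maximal_ideal M' -> forall x, M' x <-> M x.

Definition prime_chain n (Q : nat -> R -> Prop) :=
  (forall i, (i <= n)%N -> is_prime_ideal (Q i)) /\
  (forall i, (i < n)%N ->
     (forall x, Q i x -> Q i.+1 x) /\ exists2 x, Q i.+1 x & ~ Q i x).

Definition krull_dim n :=
  (exists Q, prime_chain n Q) /\ ~ exists Q, prime_chain n.+1 Q.

Definition is_regular_local :=
  is_noetherian /\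
  exists M, is_local_with M /\
  exists n, krull_dim n /\ exists s : 'I_n -> R, generated_by s M.

End RegularLocal.

(* Finite direct sums of a family of modules of varying type.  Throughout,    *)
(* a finitely generated free R-module is a vectType R.                        *)

Section DirectSum.
Variables (R : nzRingType) (t : nat) (V : 'I_t -> vectType R).

Definition dsum : Type := {dffun forall i, V i}.

Definition dsum_of (f : forall i, V i) : dsum := [ffun i => f i].
Definition dsum_at (x : dsum) i : V i := x i.

HB.instance Definition _ := Choice.copy dsum {dffun forall i, V i}.

Lemma dsumE f i : dsum_at (dsum_of f) i = f i.
Proof. by rewrite /dsum_at ffunE. Qed.

Lemma dsumP (x y : dsum) : (forall i, dsum_at x i = dsum_at y i) -> x = y.
Proof. by move=> h; apply/ffunP => i; apply: h. Qed.

Let add (x y : dsum) := dsum_of (fun i => dsum_at x i + dsum_at y i).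
Let opp (x : dsum) := dsum_of (fun i => - dsum_at x i).
Let zero := dsum_of (fun i => 0).
Let scale a (x : dsum) := dsum_of (fun i => a *: dsum_at x i).

Let addA : associative add.
Proof. by move=> x y z; apply: dsumP => i; rewrite !dsumE addrA. Qed.
Let addC : commutative add.
Proof. by move=> x y; apply: dsumP => i; rewrite !dsumE addrC. Qed.
Let add0 : left_id zero add.
Proof. by move=> x; apply: dsumP => i; rewrite !dsumE add0r. Qed.
Let addN : left_inverse zero opp add.
Proof. by move=> x; apply: dsumP => i; rewrite !dsumE addNr. Qed.

HB.instance Definition _ := GRing.isZmodule.Build dsum addA addC add0 addN.

Let scaleA a b x : scale a (scale b x) = scale (a * b) x.
Proof. by apply: dsumP => i; rewrite !dsumE scalerA. Qed.
Let scale1 : left_id 1 scale.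
Proof. by move=> x; apply: dsumP => i; rewrite !dsumE scale1r. Qed.
Let scaleDr : right_distributive scale +%R.
Proof. by move=> a x y; apply: dsumP => i; rewrite !dsumE scalerDr. Qed.
Let scaleDl x : {morph scale^~ x : a b / a + b}.
Proof. by move=> a b; apply: dsumP => i; rewrite !dsumE scalerDl. Qed.

HB.instance Definition _ :=
  GRing.Zmodule_isLmodule.Build R dsum scaleA scale1 scaleDr scaleDl.

Fact dsum_at_is_linear i : linear (fun x : dsum => dsum_at x i).
Proof. by move=> a x y; rewrite !dsumE. Qed.

Import VectorInternalTheory.

Fact dsum_vect_iso : Vector.axiom (\sum_i dim (V i)) dsum.
Proof.
pose f (x : dsum) := \mxrow_i v2r (dsum_at x i).
have v2rP (W : vectType R) : linear (v2r : W -> _).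
  by move=> a u w; rewrite linearP.
exists f.
  move=> a x y; apply/mxrowP => i; rewrite submxrowD /f !mxrowK.
  rewrite dsum_at_is_linear v2rP; congr (_ + _).
  by rewrite -[in LHS](mxrowK (fun i => v2r (dsum_at x i))); apply/matrixP => j k; rewrite !mxE.
exists (fun r => dsum_of (fun i => r2v (submxrow r i))).
  by move=> x; apply: dsumP => i; rewrite dsumE /f mxrowK v2rK.
by move=> r; apply/mxrowP => i; rewrite /f mxrowK dsumE r2vK.
Qed.

HB.instance Definition _ := Lmodule_hasFinDim.Build R dsum dsum_vect_iso.

End DirectSum.

(* Complexes of finitely generated free modules, DG-algebras, DG-modules.     *)

Record complex (R : comNzRingType) := Complex {
  cobj :> nat -> vectType R;
  cdif : forall n, {linear cobj n.+1 -> cobj n};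
  cdifK : forall n (x : cobj n.+2), cdif n (cdif n.+1 x) = 0
}.

Arguments cdif {R} c n.

Definition degcast (R : comNzRingType) (C : complex R) m n (e : m = n) :
  C m -> C n := fun x => ecast n (C n) e x.

(* The Leibniz rule is split according to whether the degrees of the factors  *)
(* are positive: the differential vanishes in degree 0.                       *)
Record dg_algebra (R : comNzRingType) (C : complex R) (u : C 0%N) := DGAlgebra {
  dmul : forall i j, C i -> C j -> C (i + j)%N;
  dmul_linl : forall i j (y : C j), linear (fun x : C i => dmul x y);
  dmul_linr : forall i j (x : C i), linear (dmul x : C j -> C (i + j)%N);
  dmul_1l : forall j (y : C j), dmul u y = y;
  dmul_1r : forall i (x : C i), dmul x u = degcast (esym (addn0 i)) x;
  dmulA : forall i j k (x : C i) (y : C j) (z : C k),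
    dmul (dmul x y) z = degcast (addnA i j k) (dmul x (dmul y z));
  dmul_leibniz : forall i j (x : C i.+1) (y : C j.+1),
    cdif C (i + j.+1)%N (dmul x y) =
      dmul (cdif C i x) y +
      (-1) ^+ i.+1 *: degcast (esym (addnS i j)) (dmul x (cdif C j y));
  dmul_leibniz0l : forall j (x : C 0%N) (y : C j.+1),
    cdif C j (dmul x y) = dmul x (cdif C j y);
  dmul_leibniz0r : forall i (x : C i.+1) (y : C 0%N),
    cdif C (i + 0)%N (dmul x y) = dmul (cdif C i x) y;
  dmulC : forall i j (x : C i) (y : C j),
    dmul x y = (-1) ^+ (i * j) *: degcast (addnC j i) (dmul y x);
  dmul_sqr0 : forall i (x : C i), odd i -> dmul x x = 0
}.

Record dg_module (R : comNzRingType) (A : complex R) (u : A 0%N)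
    (DA : dg_algebra u) (M : complex R) := DGModule {
  dact : forall i j, A i -> M j -> M (i + j)%N;
  dact_linl : forall i j (y : M j), linear (fun x : A i => dact x y);
  dact_linr : forall i j (x : A i), linear (dact x : M j -> M (i + j)%N);
  dact_1 : forall j (y : M j), dact u y = y;
  dactA : forall i j k (x : A i) (y : A j) (z : M k),
    dact (dmul DA x y) z = degcast (addnA i j k) (dact x (dact y z));
  dact_leibniz : forall i j (x : A i.+1) (y : M j.+1),
    cdif M (i + j.+1)%N (dact x y) =
      dact (cdif A i x) y +
      (-1) ^+ i.+1 *: degcast (esym (addnS i j)) (dact x (cdif M j y));
  dact_leibniz0l : forall j (x : A 0%N) (y : M j.+1),
    cdif M j (dact x y) = dact x (cdif M j y);
  dact_leibniz0r : forall i (x : A i.+1) (y : M 0%N),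
    cdif M (i + 0)%N (dact x y) = dact (cdif A i x) y
}.

(* Complexes 0 -> C_3 -> C_2 -> C_1 -> R.                                     *)

Record complex3 (R : comNzRingType) := Complex3 {
  c1 : vectType R;
  c2 : vectType R;
  c3 : vectType R;
  d1 : {linear c1 -> R^o};
  d2 : {linear c2 -> c1};
  d3 : {linear c3 -> c2};
  d12 : forall x, d1 (d2 x) = 0;
  d23 : forall x, d2 (d3 x) = 0
}.

Arguments d1 {R} c.
Arguments d2 {R} c.
Arguments d3 {R} c.

Section OfComplex3.
Variables (R : comNzRingType) (C : complex3 R).

Definition obj3 n : vectType R :=
  match n with
  | 0 => R^o
  | 1 => c1 C
  | 2 => c2 C
  | 3 => c3 C
  | _ => 'rV[R]_0
  end.

Definition dif3 n : {linear obj3 n.+1 -> obj3 n} :=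
  match n with
  | 0 => d1 C
  | 1 => d2 C
  | 2 => d3 C
  | n'.+3 => \0%R
  end.

Fact dif3K n (x : obj3 n.+2) : dif3 n (dif3 n.+1 x) = 0.
Proof.
by case: n x => [|[|[|n]]] x; rewrite /= ?d12 ?d23 //; exact: raddf0.
Qed.

Definition complex_of3 : complex R := Complex dif3K.

End OfComplex3.

Coercion complex_of3 : complex3 >-> complex.

(* Since the degree 0 term is R itself, the unit of a DG-algebra structure is *)
(* required to be 1 \in R.                                                    *)
Definition dg_algebra3 (R : comNzRingType) (C : complex3 R) :=
  @dg_algebra R C (1 : R^o).

Section Products3.
Variables (R : comNzRingType) (A M : complex3 R) (DA : dg_algebra3 A).

Definition mul11 (x y : c1 A) : c2 A := @dmul _ A _ DA 1 1 x y.
Definition mul12 (x : c1 A) (y : c2 A) : c3 A := @dmul _ A _ DA 1 2 x y.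

Variable act : dg_module DA M.

Definition act11 (x : c1 A) (y : c1 M) : c2 M := @dact _ A _ DA M act 1 1 x y.
Definition act21 (x : c2 A) (y : c1 M) : c3 M := @dact _ A _ DA M act 2 1 x y.

End Products3.

(* C is a free resolution of R/I; exactness at C_3 is injectivity of d_3.     *)
Definition resolves (R : comNzRingType) (C : complex3 R) (I : R -> Prop) :=
  (forall r, I r <-> exists x, d1 C x = r) /\
  (forall n (x : C n.+1), cdif C n x = 0 -> exists y, cdif C n.+1 y = x).

(* The differentials d_0^i take values in R e_0^i, viewed inside F_1.         *)
Record trimming_data (R : comNzRingType) := TrimmingData {
  tI : R -> Prop;
  tI_ideal : is_ideal tI;
  tF : complex3 R;
  tF_res : resolves tF tI;
  tn : nat;
  tF1' : vectType R;
  tinc : {linear tF1' -> c1 tF};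
  te0 : 'I_tn -> c1 tF;
  tsplit : bijective (fun p : tF1' * {ffun 'I_tn -> R} =>
                        tinc p.1 + \sum_i p.2 i *: te0 i);
  td2' : {linear c2 tF -> tF1'};
  td0 : 'I_tn -> {linear c2 tF -> c1 tF};
  td0_line : forall i x, exists c : R, td0 i x = c *: te0 i;
  td2_split : forall x, d2 tF x = tinc (td2' x) + \sum_i td0 i x;
  ta : 'I_tn -> R -> Prop;
  ta_ideal : forall i, is_ideal (ta i);
  ta_td0 : forall i x, exists2 c : R, ta i c & td0 i x = c *: te0 i;
  tG : 'I_tn -> complex3 R;
  tG_res : forall i, resolves (tG i) (ta i);
  tq1 : forall i, {linear c2 tF -> c1 (tG i)};
  tq2 : forall i, {linear c3 tF -> c2 (tG i)};
  tq1P : forall i x, (d1 (tG i) (tq1 i x) : R) *: te0 i = td0 i x;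
  tq2P : forall i x, d2 (tG i) (tq2 i x) = tq1 i (d3 tF x)
}.

(* The iterated trimming complex. *)

Section TrimmingComplex.
Variables (R : comNzRingType) (S : trimming_data R).

Let F := tF S.
Let G := @tG R S.

Definition trim1 : vectType R := (tF1' S * dsum (fun i => c1 (G i)))%type.
Definition trim2 : vectType R := (c2 F * dsum (fun i => c2 (G i)))%type.
Definition trim3 : vectType R := (c3 F * dsum (fun i => c3 (G i)))%type.

Definition ell1 (x : trim1) : R^o :=
  d1 F (tinc S x.1) -
  \sum_i (d1 (G i) (dsum_at x.2 i) : R) * (d1 F (te0 i) : R).

Definition ell2 (x : trim2) : trim1 :=
  (td2' S x.1, @dsum_of R _ (fun i => c1 (G i)) (fun i => - tq1 i x.1 + d2 (G i) (dsum_at x.2 i))).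

Definition ell3 (x : trim3) : trim2 :=
  (d3 F x.1, @dsum_of R _ (fun i => c2 (G i)) (fun i => tq2 i x.1 + d3 (G i) (dsum_at x.2 i))).

Fact ell1_is_linear : linear ell1.
Proof.
move=> a x y; rewrite /ell1 /= !linearP /= scalerBr addrACA -opprD.
congr (_ - _); rewrite scaler_sumr -big_split /=; apply: eq_bigr => i _.
by rewrite dsum_at_is_linear linearP mulrDl [in LHS]/GRing.scale /= -mulrA.
Qed.

Fact ell2_is_linear : linear ell2.
Proof.
move=> a x y; congr pair; rewrite /= ?linearP //.
apply: dsumP => i; rewrite dsumE !dsum_at_is_linear !dsumE.
by rewrite !linearP /= scalerDr addrACA.
Qed.

Fact ell3_is_linear : linear ell3.
Proof.
move=> a x y; congr pair; rewrite /= ?linearP //.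
apply: dsumP => i; rewrite dsumE !dsum_at_is_linear !dsumE.
by rewrite !linearP /= scalerDr addrACA.
Qed.

HB.instance Definition _ := GRing.isLinear.Build R trim1 R^o _ ell1 ell1_is_linear.
HB.instance Definition _ := GRing.isLinear.Build R trim2 trim1 _ ell2 ell2_is_linear.
HB.instance Definition _ := GRing.isLinear.Build R trim3 trim2 _ ell3 ell3_is_linear.

Fact ell12 x : ell1 (ell2 x) = 0.
Proof.
have := d12 (c := F) x.1; rewrite td2_split raddfD raddf_sum /= => e.
rewrite /ell1 /= -[RHS]e; congr (_ + _); rewrite -sumrN.
apply: eq_bigr => i _; rewrite dsumE raddfD raddfN /= d12 addr0 mulNr opprK.
by rewrite -tq1P linearZ.
Qed.

Fact ell23 x : ell2 (ell3 x) = 0.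
Proof.
congr pair => /=.
  have := d23 (c := F) x.1; rewrite td2_split => e.
  have z i : td0 i (d3 F x.1) = 0.
    by rewrite -tq1P -tq2P d12 scale0r.
  move: e; rewrite big1 // addr0 => e.
  have inc0 (y : tF1' S) : tinc S y = 0 -> y = 0.
    move=> y0; suff: (y, 0) = (0, 0) :> tF1' S * {ffun 'I_(tn S) -> R} by case.
    by apply: (bij_inj (tsplit S)); rewrite /= y0 linear0.
  exact: inc0.
apply: dsumP => i; rewrite dsumE dsumE raddfD /= d23 addr0 tq2P addNr.
by rewrite dsumE.
Qed.

Definition trimming_complex : complex3 R := Complex3 ell12 ell23.

End TrimmingComplex.

(* The module structures are over the given DG-algebra structures, and that   *)
(* of G^i over itself is multiplication.                                      *)
Record trimming_dg (R : comNzRingType) (S : trimming_data R) := TrimmingDG {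
  dgF : dg_algebra3 (tF S);
  dgG : forall i, dg_algebra3 (@tG R S i);
  dgact : forall i j, dg_module (dgG i) (@tG R S j);
  dgact_diag : forall i a b (x : tG i a) (y : tG i b),
    dact (dgact i i) x y = dmul (dgG i) x y
}.

Section TrimmingProducts.
Variables (R : comNzRingType) (S : trimming_data R) (A : trimming_dg S).
Variable D : dg_algebra3 (trimming_complex S).

Let F := tF S.
Let G := @tG R S.
Let e := @te0 R S.
Let inc : tF1' S -> c1 F := tinc S.
Let q1 := @tq1 R S.
Let m1 i (g : c1 (G i)) : R := d1 (G i) g.

(* Inclusions of the summands F_1', G_1^i into T_1 and G_2^i into T_2. *)
Definition single (V : 'I_(tn S) -> vectType R) i (v : V i) : dsum V :=
  @dsum_of R _ V (dfwith (fun j => 0 : V j) v).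
Definition inF1 (f : tF1' S) : trim1 S := (f, 0).
Definition inG1 i (g : c1 (G i)) : trim1 S := (0, single (V := fun j => c1 (G j)) g).
Definition inG2 i (g : c2 (G i)) : trim2 S := (0, single (V := fun j => c2 (G j)) g).

Let in2 (f : c2 F) (g : forall k, c2 (G k)) : trim2 S :=
  (f, @dsum_of R _ (fun k => c2 (G k)) g).
Let in3 (f : c3 F) (g : forall k, c3 (G k)) : trim3 S :=
  (f, @dsum_of R _ (fun k => c3 (G k)) g).

Local Notation "x *F y" := (mul11 (dgF A) x y) (at level 40).
(* act1 g q and act2 g q: the action of g \in G^i on q \in G^k. *)
Let act1 i k : c1 (G i) -> c1 (G k) -> c2 (G k) := act11 (dgact A i k).
Let act2 i k : c2 (G i) -> c1 (G k) -> c3 (G k) := act21 (dgact A i k).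

Definition product_F1_G1 := forall (f1 : tF1' S) i (g1 : c1 (G i)),
  mul11 D (inF1 f1) (inG1 g1) =
    in2 (m1 g1 *: (e i *F inc f1))
        (fun j => act1 g1 (q1 j (e i *F inc f1))).

Definition product_G1_G1 := forall i j (gi : c1 (G i)) (gj : c1 (G j)),
  (i < j)%N ->
  mul11 D (inG1 gi) (inG1 gj) =
    in2 ((m1 gi * m1 gj) *: (e i *F e j))
        (fun k => if k == i then m1 gj *: act1 gi (q1 k (e i *F e j))
                  else if k == j then m1 gi *: act1 gj (q1 k (e i *F e j))
                  else m1 gi *: act1 gj (q1 k (e i *F e j))).

Definition product_F1_G2 := forall (f1 : tF1' S) i (g2 : c2 (G i)),
  mul12 D (inF1 f1) (inG2 g2) =
    in3 0 (fun j => - act2 g2 (q1 j (e i *F inc f1))).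

Definition product_G1_G2 := forall i j (g1 : c1 (G i)) (g2 : c2 (G j)),
  i != j ->
  mul12 D (inG1 g1) (inG2 g2) =
    in3 0 (fun k =>
      if (i < j)%N then
        if k != i then - (m1 g1 *: act2 g2 (q1 k (e i *F e j))) else 0
      else
        if k == j then - (m1 g1 *: act2 g2 (q1 k (e i *F e j))) else 0).

Definition extends_products :=
  [/\ product_F1_G1, product_G1_G1, product_F1_G2 & product_G1_G2].

End TrimmingProducts.

(* The standard graded case, with internal degrees in int.                    *)

Section Graded.
Variables (k : fieldType) (n : nat).
Let R : comNzRingType := {mpoly k[n]}.

Definition ring_homog (d : int) (r : R) : Prop :=
  match d with Posz m => r \is m.-homog | Negz _ => r = 0 end.

(* V is the direct sum of the shifts R(- gdeg i). *)
Record grading (V : vectType R) := Grading {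
  grank : nat;
  gbasis : 'I_grank -> V;
  gdeg : 'I_grank -> int;
  gbasisP : bijective (fun c : {ffun 'I_grank -> R} => \sum_i c i *: gbasis i)
}.

Arguments gbasis {V} g i.
Arguments gdeg {V} g i.

Definition is_homog (V : vectType R) (g : grading V) (d : int) (v : V) :=
  exists2 c : 'I_(grank g) -> R,
    v = \sum_i c i *: gbasis g i & forall i, ring_homog (d - gdeg g i) (c i).

Record graded_complex3 (C : complex3 R) := GradedComplex3 {
  gr1 : grading (c1 C);
  gr2 : grading (c2 C);
  gr3 : grading (c3 C);
  gr_d1 : forall d x, is_homog gr1 d x -> ring_homog d (d1 C x);
  gr_d2 : forall d x, is_homog gr2 d x -> is_homog gr1 d (d2 C x);
  gr_d3 : forall d x, is_homog gr3 d x -> is_homog gr2 d (d3 C x)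
}.

Definition homog3 (C : complex3 R) (g : graded_complex3 C) m (d : int) :
  C m -> Prop :=
  match m with
  | 0 => ring_homog d
  | 1 => is_homog (gr1 g) d
  | 2 => is_homog (gr2 g) d
  | 3 => is_homog (gr3 g) d
  | _ => fun=> True
  end.

Definition homog_products (C : complex3 R) (h : forall m, int -> C m -> Prop)
    (D : dg_algebra3 C) :=
  forall i j d d' (x : C i) (y : C j),
    h i d x -> h j d' y -> h (i + j)%N (d + d') (dmul D x y).

(* Since e_0^i has degree gr_eps i, the maps q^i have degree - gr_eps i.      *)
Record graded_trimming (S : trimming_data R) (A : trimming_dg S) :=
  GradedTrimming {
  grF : graded_complex3 (tF S);
  grF1' : grading (tF1' S);
  grG : forall i, graded_complex3 (@tG R S i);
  gr_eps : 'I_(tn S) -> int;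
  gr_inc : forall d x, is_homog grF1' d x -> is_homog (gr1 grF) d (tinc S x);
  gr_e0 : forall i, is_homog (gr1 grF) (gr_eps i) (te0 i);
  gr_q1 : forall i d x, is_homog (gr2 grF) d x ->
    is_homog (gr1 (grG i)) (d - gr_eps i) (tq1 i x);
  gr_q2 : forall i d x, is_homog (gr3 grF) d x ->
    is_homog (gr2 (grG i)) (d - gr_eps i) (tq2 i x);
  gr_dgF : homog_products (homog3 grF) (dgF A);
  gr_dgG : forall i, homog_products (homog3 (grG i)) (dgG A i);
  gr_dgact : forall i j a b d d' (x : tG i a) (y : tG j b),
    homog3 (grG i) d x -> homog3 (grG j) d' y ->
    homog3 (grG j) (d + d') (dact (dgact A i j) x y)
}.

(* In T the complex G^i is shifted by gr_eps i, which makes ell homogeneous.  *)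
Definition trim_homog (S : trimming_data R) (A : trimming_dg S)
    (g : graded_trimming A) m (d : int) : trimming_complex S m -> Prop :=
  match m with
  | 0 => ring_homog d
  | 1 => fun x => is_homog (grF1' g) d x.1 /\
      forall i, is_homog (gr1 (grG g i)) (d - gr_eps g i) (dsum_at x.2 i)
  | 2 => fun x => is_homog (gr2 (grF g)) d x.1 /\
      forall i, is_homog (gr2 (grG g i)) (d - gr_eps g i) (dsum_at x.2 i)
  | 3 => fun x => is_homog (gr3 (grF g)) d x.1 /\
      forall i, is_homog (gr3 (grG g i)) (d - gr_eps g i) (dsum_at x.2 i)
  | _ => fun=> True
  end.

End Graded.

(* Main.v *)
Require Import Defs.
From HB Require Import structures.
From mathcomp Require Import all_boot all_order all_algebra.
From mathcomp Require Import mpoly ring.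

Set Implicit Arguments.
Unset Strict Implicit.
Unset Printing Implicit Defensive.

Import GRing.Theory.
Local Open Scope ring_scope.

(** The idea is that on a free resolution of length three only the product of
    two elements of degree one has to be constructed. If T_1 x T_1 -> T_2 is
    bilinear, alternating and satisfies the Leibniz rule, then for x in T_1 and
    y in T_2 the element d(x) y - x d(y) of T_2 is a cycle, hence the boundary
    of a unique element of T_3, and this element has to be x y. As d_3 is
    injective, every remaining identity between elements of T_3 (bilinearity,
    associativity, the Leibniz rule in degree four) can be checked after
    applying d_3, where it follows from the identities in degree two. This is
    [extend_product]; it needs exactness of T in degrees two and three only,
    which is proved directly in [trim_exact2] and [trim_d3_inj].

    On the iterated trimming complex the products F_1' x G_1^i and
    G_1^i x G_1^j are those of the theorem. The ones left open are
      - G_1^i x G_1^i, where - d_1(e_i) g .g' with the product of G^i works;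
      - F_1' x F_1', where f f' has F_2-component the product in F, and
        G_2^k-component a preimage of q_1^k(f f') under m_2^k. Such a preimage
        exists because the components of d_2(f f') along the e_k vanish, so
        that m_1^k q_1^k(f f') = 0. A choice on pairs of basis vectors extends
        to an alternating form ([alt_form]).
    All the Leibniz rules rest on the same observation, [q_FF], [q_GF] and
    [q_GG]: the Leibniz rule in F determines the components of d_2 of a product
    in F_2, and m_1^k q_1^k is the component along e_k. It vanishes but for the
    k that are the indices of the factors, and there the terms that involve the
    action on 1 in G^k_0 are actions of G^k on itself, hence scalars
    ([aug1_diag], [aug2_diag]). The formulas of the theorem for F_1' x G_2^i
    and G_1^i x G_2^j need no choice: both sides have the same boundary and d_3
    is injective.

    In the graded case all these formulas are homogeneous, and the preimages
    can be replaced by their homogeneous parts of the right degree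
    ([homog_lift]). The same projection shows that an injective graded map
    reflects homogeneity, which gives the claim for the products in T_3. *)

(** * Bilinear maps *)

Section Bilinear.
Variable R : comNzRingType.
Implicit Types U V W : lmodType R.

Definition bilin U V W (B : U -> V -> W) :=
  (forall y, linear (B^~ y)) /\ (forall x, linear (B x)).

Lemma linD U V (f : U -> V) : linear f -> {morph f : x y / x + y}.
Proof. by move=> h x y; have := h 1 x y; rewrite !scale1r. Qed.

Lemma lin0 U V (f : U -> V) : linear f -> f 0 = 0.
Proof. by move=> h; apply: (addrI (f 0)); rewrite -(linD h) !addr0. Qed.

Lemma linZ U V (f : U -> V) : linear f -> forall a, {morph f : x / a *: x}.
Proof. by move=> h a x; have := h a x 0; rewrite !addr0 (lin0 h) addr0. Qed.

Lemma linN U V (f : U -> V) : linear f -> {morph f : x / - x}.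
Proof. by move=> h x; rewrite -scaleN1r (linZ h) scaleN1r. Qed.

Lemma linB U V (f : U -> V) : linear f -> {morph f : x y / x - y}.
Proof. by move=> h x y; rewrite (linD h) (linN h). Qed.

Lemma lin_sum U V (f : U -> V) I (r : seq I) (P : pred I) (F : I -> U) :
  linear f -> f (\sum_(i <- r | P i) F i) = \sum_(i <- r | P i) f (F i).
Proof. by move=> h; apply: (big_morph f (linD h) (lin0 h)). Qed.

Lemma bilin_comp U U' V V' W (B : U -> V -> W) (f : U' -> U) (g : V' -> V) :
  linear f -> linear g -> bilin B -> bilin (fun x y => B (f x) (g y)).
Proof.
by move=> hf hg [hl hr]; split=> y a u v; [rewrite hf hl | rewrite hg hr].
Qed.

Lemma bilin_lcomp U V W W' (B : U -> V -> W) (f : W -> W') :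
  linear f -> bilin B -> bilin (fun x y => f (B x y)).
Proof. by move=> hf [hl hr]; split=> y a u v; rewrite (hl, hr) hf. Qed.

Lemma bilinC U V W (B : U -> V -> W) : bilin B -> bilin (fun y x => B x y).
Proof. by case. Qed.

Lemma bilinD U V W (B B' : U -> V -> W) :
  bilin B -> bilin B' -> bilin (fun x y => B x y + B' x y).
Proof.
by move=> [hl hr] [hl' hr']; split=> y a u v;
  rewrite (hl, hr) (hl', hr') scalerDr addrACA.
Qed.

Lemma bilinN U V W (B : U -> V -> W) : bilin B -> bilin (fun x y => - B x y).
Proof.
by move=> [hl hr]; split=> y a u v; rewrite (hl, hr) opprD scalerN.
Qed.

Lemma bilinB U V W (B B' : U -> V -> W) :
  bilin B -> bilin B' -> bilin (fun x y => B x y - B' x y).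
Proof. by move=> hB hB'; apply/bilinD/bilinN. Qed.

Lemma bilin_zero U V W : bilin (fun (_ : U) (_ : V) => 0 : W).
Proof. by split=> y a u v; rewrite scaler0 addr0. Qed.

Lemma bilin_sum U V W I (r : seq I) (P : pred I) (B : I -> U -> V -> W) :
  (forall i, bilin (B i)) -> bilin (fun x y => \sum_(i <- r | P i) B i x y).
Proof.
move=> hB; split=> y a u v; rewrite scaler_sumr -big_split;
  by apply: eq_bigr => i _; have [hl hr] := hB i; rewrite (hl, hr).
Qed.

Lemma bilin_scale U V W (B : U -> V -> W) c :
  bilin B -> bilin (fun x y => c *: B x y).
Proof.
by move=> [hl hr]; split=> y a u v; rewrite (hl, hr) scalerDr !scalerA mulrC.
Qed.

(** The linear form takes values in the regular module, so that its linearity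
    makes sense for the module structure that the differential d_1 uses. *)
Lemma bilin_lscale U V W (a : U -> R^o) (f : V -> W) :
  linear a -> linear f -> bilin (fun x y => a x *: f y).
Proof.
move=> ha hf; split=> y c u v; first by rewrite ha scalerDl scalerA.
by rewrite hf scalerDr !scalerA mulrC.
Qed.

Lemma bilin_pair U V W W' (B : U -> V -> W) (B' : U -> V -> W') :
  bilin B -> bilin B' -> bilin (fun x y => (B x y, B' x y) : (W * W')%type).
Proof.
by move=> [hl hr] [hl' hr']; split=> y a u v; rewrite (hl, hr) (hl', hr').
Qed.

Lemma bilin_dsum t U V (W : 'I_t -> vectType R) (B : forall i, U -> V -> W i) :
  (forall i, bilin (B i)) -> bilin (fun x y => dsum_of (fun i => B i x y)).
Proof.
move=> hB; split=> y a u v; apply: dsumP => i;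
  by have [hl hr] := hB i; rewrite dsum_at_is_linear !dsumE (hl, hr).
Qed.

Lemma alt_anti U W (B : U -> U -> W) :
  bilin B -> (forall x, B x x = 0) -> forall x y, B y x = - B x y.
Proof.
move=> [hl hr] alt x y; apply/eqP; rewrite -addr_eq0; apply/eqP.
have := alt (x + y); rewrite (linD (hl _)) !(linD (hr _)) !alt add0r addr0.
by rewrite addrC.
Qed.

End Bilinear.

(** * From a product in degree one to an algebra structure *)

Section ExtendProduct.
Variables (R : comNzRingType) (C : complex3 R).

Lemma degcast_id n (e : n = n) (x : C n) : degcast e x = x.
Proof. by rewrite (eq_irrelevance e (erefl n)). Qed.

Lemma obj3_triv n (x y : C n) : (3 < n)%N -> x = y.
Proof. by case: n x y => [|[|[|[|n]]]] x y // _; apply/matrixP => i []. Qed.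

Variable p11 : c1 C -> c1 C -> c2 C.
Hypothesis p11_bilin : bilin p11.
Hypothesis p11_alt : forall x, p11 x x = 0.
Hypothesis p11_leib : forall x y,
  d2 C (p11 x y) = (d1 C x : R) *: y - (d1 C y : R) *: x.
Hypothesis d3_inj : forall x, d3 C x = 0 -> x = 0.
Hypothesis ex2 : forall x, d2 C x = 0 -> exists y, d3 C y = x.

Let p12_ex (x : c1 C) (y : c2 C) :
  exists z, d3 C z == (d1 C x : R) *: y - p11 x (d2 C y).
Proof.
have [|z dz] := ex2 (x := (d1 C x : R) *: y - p11 x (d2 C y)); last first.
  by exists z; apply/eqP.
by rewrite raddfB /= linearZ /= p11_leib d12 scale0r subr0 subrr.
Qed.

Let p12 x y := xchoose (p12_ex x y).

Let d3p12 x y : d3 C (p12 x y) = (d1 C x : R) *: y - p11 x (d2 C y).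
Proof. exact: eqP (xchooseP (p12_ex x y)). Qed.

Let d3I x y : d3 C x = d3 C y -> x = y.
Proof.
move=> e; apply/eqP; rewrite -subr_eq0; apply/eqP/d3_inj.
by rewrite raddfB /= e subrr.
Qed.

Let p12_bilin : bilin p12.
Proof.
have [hl hr] := p11_bilin.
split=> y a u v; apply: d3I; rewrite linearP /= !d3p12.
  by rewrite hl linearP /= scalerBr scalerDl scalerA opprD addrACA.
rewrite (linearP (d2 C)) /= hr !scalerDr opprD scalerN !scalerA addrACA.
by rewrite [a * _]mulrC.
Qed.

Let p11_anti := alt_anti p11_bilin p11_alt.

(** The products of two elements of positive degree: they vanish when the sum of
    the degrees exceeds three, and x y = y x for x of degree two. *)
Definition dprodS i j : obj3 C i.+1 -> obj3 C j.+1 -> obj3 C (i.+1 + j.+1) :=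
  match i, j return obj3 C i.+1 -> obj3 C j.+1 -> obj3 C (i.+1 + j.+1) with
  | 0, 0 => p11
  | 0, 1 => p12
  | 1, 0 => fun x y => p12 y x
  | _, _ => fun _ _ => 0
  end.

Definition dprod i j : obj3 C i -> obj3 C j -> obj3 C (i + j) :=
  match i return obj3 C i -> obj3 C j -> obj3 C (i + j) with
  | 0 => fun r y => (r : R) *: y
  | i.+1 =>
    match j return obj3 C i.+1 -> obj3 C j -> obj3 C (i.+1 + j) with
    | 0 => fun x r => degcast (C := C) (esym (addn0 i.+1)) ((r : R) *: x)
    | j.+1 => @dprodS i j
    end
  end.

Lemma degcast_lin m n (e : m = n) : linear (@degcast R C m n e).
Proof. by case: _ / e. Qed.

Lemma dprod_bilin i j : bilin (@dprod i j).
Proof.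
have sc (V : vectType R) : bilin (fun (r : R^o) (y : V) => (r : R) *: y).
  by apply: bilin_lscale.
case: i => [|i]; first exact: sc.
case: j => [|j].
  exact: (bilin_lcomp (@degcast_lin _ _ (esym (addn0 i.+1)))
                      (bilinC (sc (C i.+1)))).
case: i => [|[|i]]; case: j => [|[|j]]; try exact: bilin_zero.
- exact: p11_bilin.
- exact: p12_bilin.
- exact: bilinC p12_bilin.
Qed.

Let dprod_linl i j (y : obj3 C j) : linear (fun x => @dprod i j x y).
Proof. by case: (@dprod_bilin i j) => h _; apply: h. Qed.

Let dprod_linr i j (x : obj3 C i) : linear (@dprod i j x).
Proof. by case: (@dprod_bilin i j) => _; apply. Qed.

Lemma degcast_trans m n p (e : m = n) (e' : n = p) (x : C m) :
  degcast e' (degcast e x) = degcast (etrans e e') x.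
Proof. by case: _ / e'. Qed.

Lemma degcast_irr m n (e e' : m = n) (x : C m) : degcast e x = degcast e' x.
Proof. by rewrite (eq_irrelevance e e'). Qed.

Lemma cdif_degcast m n (e : m.+1 = n.+1) (e' : m = n) (x : C m.+1) :
  cdif C n (degcast e x) = degcast e' (cdif C m x).
Proof. by subst n; rewrite !degcast_id. Qed.

Lemma dprod_castl i i' j (e : i = i') (x : C i) (y : C j) :
  dprod (degcast e x) y =
    degcast (C := C) (congr1 (addn^~ j) e) (dprod x y).
Proof. by case: _ / e. Qed.

Lemma dprod_castr i j j' (e : j = j') (x : C i) (y : C j) :
  dprod x (degcast e y) =
    degcast (C := C) (congr1 (addn i) e) (dprod x y).
Proof. by case: _ / e. Qed.

(** This reduces every axiom with a factor of degree zero to bilinearity. *)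
Lemma dprod_r0 i (x : C i) (r : R^o) :
  dprod (j := 0) x r = degcast (C := C) (esym (addn0 i)) ((r : R) *: x).
Proof.
case: i x => [|i] x //; rewrite degcast_id.
exact: mulrC.
Qed.

Lemma dprodA i j k (x : C i) (y : C j) (z : C k) :
  dprod (dprod x y) z = degcast (C := C) (addnA i j k) (dprod x (dprod y z)).
Proof.
case: i x => [|i] x.
  exact: etrans (linZ (dprod_linl z) x y) (esym (degcast_id _ _)).
case: j y => [|j] y.
  rewrite dprod_r0 dprod_castl (linZ (dprod_linl z) y x).
  rewrite -(linZ (dprod_linr x) y z); exact: degcast_irr.
case: k z => [|k] z.
  rewrite !dprod_r0 dprod_castr degcast_trans (linZ (dprod_linr x) z y).
  exact: degcast_irr.
have [h|h] := ltnP 3 (i.+1 + j.+1 + k.+1); first exact: obj3_triv.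
have /and3P[/eqP i0 /eqP j0 /eqP k0] : [&& i == 0, j == 0 & k == 0]%N.
  by move: h; rewrite !addSn !addnS !ltnS leqn0 !addn_eq0 -andbA.
subst i j k; rewrite degcast_id; apply: d3I.
(* after applying d_3, both sides expand to d(x) yz - d(y) xz + d(z) xy *)
have [hl hr] := p11_bilin.
rewrite [dprod _ z]/(p12 z (p11 x y)) [dprod x _]/(p12 x (p11 y z)).
rewrite !d3p12 !p11_leib.
rewrite !(linB (hr _)) !(linZ (hr _)) [p11 z x]p11_anti [p11 z y]p11_anti.
by rewrite !scalerN !opprD !opprK addrCA [X in _ + X = _]addrC.
Qed.

(** Acyclicity in degrees two and three makes the product in degree one the only
    datum: the other products are forced and the axioms follow. *)
Lemma extend_product :
  exists D : dg_algebra3 C, forall x y, mul11 D x y = p11 x y.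
Proof.
have hC i j (x : C i) (y : C j) :
    dprod x y = (-1) ^+ (i * j) *: degcast (C := C) (addnC j i) (dprod y x).
  case: i x => [|i] x.
    rewrite mul0n scale1r dprod_r0 degcast_trans degcast_id.
    by [].
  case: j y => [|j] y.
    by rewrite muln0 scale1r dprod_r0; exact: degcast_irr.
  have [h|h] := ltnP 3 (i.+1 + j.+1); first exact: obj3_triv.
  have {h}: (i + j <= 1)%N by move: h; rewrite addSn addnS !ltnS.
  case: i x => [|[|i]] x; case: j y => [|[|j]] y // _; rewrite degcast_id.
  - rewrite expr1 scaleN1r; exact: p11_anti.
  - by rewrite expr2 mulrNN mulr1 scale1r.
  - by rewrite expr2 mulrNN mulr1 scale1r.
have hleib i j (x : C i.+1) (y : C j.+1) :
    cdif C (i + j.+1)%N (dprod x y) =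
      dprod (cdif C i x) y +
      (-1) ^+ i.+1 *:
        degcast (C := C) (esym (addnS i j)) (dprod x (cdif C j y)).
  have [h|h] := ltnP 3 (i + j.+1); first exact: obj3_triv.
  have {h}: (i + j <= 2)%N by move: h; rewrite addnS ltnS.
  have [hl11 hr11] := p11_bilin; have [hl12 hr12] := p12_bilin.
  case: i x => [|[|[|i]]] x; case: j y => [|[|[|j]]] y // _; rewrite degcast_id.
  - rewrite expr1 scaleN1r dprod_r0 degcast_id; exact: p11_leib.
  - rewrite expr1 scaleN1r; exact: d3p12.
  - rewrite expr1 scaleN1r; apply: d3I; rewrite raddfB raddf0 /=.
    by rewrite linearZ /= d3p12 d23 (lin0 (hr11 _)) subr0 subrr.
  - rewrite expr2 mulrNN mulr1 scale1r dprod_r0 degcast_id.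
    rewrite [LHS]d3p12 addrC; congr (_ + _); exact: esym (p11_anti _ _).
  - rewrite expr2 mulrNN mulr1 scale1r; apply: d3I; rewrite raddfD raddf0 /=.
    rewrite !d3p12 !d12 !scale0r !sub0r p11_anti opprK subrr.
    by [].
  - rewrite exprS expr2 mulrNN mulr1 mulr1 scaleN1r dprod_r0 degcast_id.
    apply: d3I; rewrite raddfB raddf0 /= linearZ /= [X in _ = X - _]d3p12 d23 .
    by rewrite (lin0 (hr11 _)) subr0 subrr.
have hl0 j (x : C 0%N) (y : C j.+1) :
    cdif C j (dprod x y) = dprod x (cdif C j y) by exact: linearZ.
have hr0 i (x : C i.+1) (y : C 0%N) :
    cdif C (i + 0)%N (dprod x y) = dprod (cdif C i x) y.
  by rewrite !dprod_r0 (cdif_degcast _ (esym (addn0 i))) linearZ.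
have hs i (x : C i) : odd i -> dprod x x = 0.
  case: i x => [|[|i]] x hi; first by [].
    exact: (p11_alt x).
  by apply: obj3_triv; rewrite !addSn !addnS.
have h1 i (x : C i) :
    dprod (j := 0) x (1 : R^o) = degcast (C := C) (esym (addn0 i)) x.
  by rewrite dprod_r0 scale1r.
by exists (@DGAlgebra R C (1 : R^o) dprod dprod_linl dprod_linr
             (fun j (y : C j) => scale1r y) h1 dprodA hleib hl0 hr0 hC hs).
Qed.
End ExtendProduct.

(** * Low degree identities for algebras and modules *)

Section LowDegree.
Variables (R : comNzRingType) (C : complex3 R) (D : dg_algebra3 C).

Lemma dmul_scalar j (r : R^o) (y : C j) : dmul D (i := 0) r y = (r : R) *: y.
Proof.
have := linZ (dmul_linl D (i := 0) y) r (1 : R^o); rewrite dmul_1l => <-.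
by congr (dmul D _ _); rewrite /GRing.scale /= mulr1.
Qed.

Lemma mul11_bilin : bilin (mul11 D).
Proof.
by split=> y a u v;
  [exact: (dmul_linl D (i := 1) (j := 1) y a u v) |
   exact: (dmul_linr D (i := 1) (j := 1) y a u v)].
Qed.

Lemma mul11_alt x : mul11 D x x = 0.
Proof. exact: (dmul_sqr0 D (i := 1)). Qed.

Lemma mul11_leibniz x y :
  d2 C (mul11 D x y) = (d1 C x : R) *: y - (d1 C y : R) *: x.
Proof.
have := dmul_leibniz D (i := 0) (j := 0) x y.
rewrite expr1 scaleN1r degcast_id dmul_scalar => ->; congr (_ - _).
rewrite dmulC dmul_scalar muln0 expr0 scale1r.
exact: (@degcast_id _ C 1 (addnC 0 1)).
Qed.

Lemma mul12_leibniz x y :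
  d3 C (mul12 D x y) = (d1 C x : R) *: y - mul11 D x (d2 C y).
Proof.
have := dmul_leibniz D (i := 0) (j := 1) x y.
by rewrite expr1 scaleN1r degcast_id dmul_scalar => ->.
Qed.

Variables (M : complex3 R) (act : dg_module D M).

(** The action on the element 1 of M_0, which appears in the Leibniz rule for the
    action on M_1. It is the identity when the algebra acts on itself, and not
    controlled otherwise. *)
Definition unit_act1 (x : c1 C) : c1 M :=
  dact act (i := 1) (j := 0) x (1 : R^o).

Definition unit_act2 (x : c2 C) : c2 M :=
  dact act (i := 2) (j := 0) x (1 : R^o).

Lemma act11_bilin : bilin (act11 act).
Proof.
by split=> y a u v;
  [exact: (dact_linl act (i := 1) (j := 1) y a u v) |
   exact: (dact_linr act (i := 1) (j := 1) y a u v)].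
Qed.

Lemma act21_bilin : bilin (act21 act).
Proof.
by split=> y a u v;
  [exact: (dact_linl act (i := 2) (j := 1) y a u v) |
   exact: (dact_linr act (i := 2) (j := 1) y a u v)].
Qed.

Lemma dact_scalar j (r : R^o) (y : M j) : dact act (i := 0) r y = (r : R) *: y.
Proof.
have := linZ (dact_linl act (i := 0) y) r (1 : R^o); rewrite dact_1 => <-.
by congr (dact act _ _); rewrite /GRing.scale /= mulr1.
Qed.

Lemma dact_aug i (x : C i) (r : R^o) :
  dact act (j := 0) x r = (r : R) *: dact act (j := 0) x (1 : R^o).
Proof.
have := linZ (dact_linr act (j := 0) x) r (1 : R^o) => <-.
by congr (dact act _ _); rewrite /GRing.scale /= mulr1.
Qed.

Lemma act11_leibniz x y :
  d2 M (act11 act x y) = (d1 C x : R) *: y - (d1 M y : R) *: unit_act1 x.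
Proof.
have := dact_leibniz act (i := 0) (j := 0) x y.
by rewrite expr1 scaleN1r degcast_id dact_scalar dact_aug => ->.
Qed.

Lemma act21_leibniz x y :
  d3 M (act21 act x y) = act11 act (d2 C x) y + (d1 M y : R) *: unit_act2 x.
Proof.
have := dact_leibniz act (i := 1) (j := 0) x y.
by rewrite expr2 mulrNN mulr1 scale1r degcast_id dact_aug => ->.
Qed.

End LowDegree.

Section DirectSums.
Variables (R : comNzRingType) (S : trimming_data R).
Variable V : 'I_(tn S) -> vectType R.

Lemma single_at i (v : V i) : dsum_at (single v) i = v.
Proof. by rewrite dsumE dfwith_in. Qed.

Lemma single_out i (v : V i) j : j != i -> dsum_at (single v) j = 0.
Proof. by move=> ji; rewrite dsumE dfwith_out // eq_sym. Qed.

Lemma sum_single (W : zmodType) (P : pred 'I_(tn S))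
    (f : forall j, V j -> W) i (v : V i) :
  (forall j, f j 0 = 0) ->
  \sum_(j | P j) f j (dsum_at (single v) j) = if P i then f i v else 0.
Proof.
move=> f0; case: ifP => Pi.
  rewrite (bigD1 i) //= single_at big1 ?addr0 // => j /andP[_ ji].
  by rewrite single_out.
rewrite big1 // => j Pj; rewrite single_out //.
by apply: contraTneq Pj => ->; rewrite Pi.
Qed.

End DirectSums.

Arguments sum_single {R S V W} P f {i} v.

(** * The trimming complex: exactness and generators of degree one *)

Section TrimmingResolution.
Variables (R : comNzRingType) (S : trimming_data R).

Let F := tF S.
Let G := @tG R S.
Let T := trimming_complex S.

(** F_1 is the direct sum of F_1' and the R e_i, so the components of d_2 x can
    be read off from any expression of d_2 x in these terms. *)
Lemma split_d2 x u (c : 'I_(tn S) -> R) :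
  d2 F x = tinc S u + \sum_i c i *: te0 i ->
  td2' S x = u /\ forall i, (d1 (G i) (tq1 i x) : R) = c i.
Proof.
rewrite td2_split => e.
have /(bij_inj (tsplit S)) [-> /ffunP ce] :
    tinc S (td2' S x, [ffun i => d1 (G i) (tq1 i x) : R]).1 +
      \sum_i (td2' S x, [ffun i => d1 (G i) (tq1 i x) : R]).2 i *: te0 i =
    tinc S (u, [ffun i => c i]).1 + \sum_i (u, [ffun i => c i]).2 i *: te0 i.
  rewrite /=; under eq_bigr do rewrite ffunE tq1P.
  by rewrite e; under [in RHS]eq_bigr do rewrite ffunE.
by split=> // i; have := ce i; rewrite !ffunE.
Qed.

Lemma d3_inj_resolves (C : complex3 R) I : resolves C I ->
  forall x, d3 C x = 0 -> x = 0.
Proof.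
by case=> _ ex x dx; have [y <-] := ex 2%N x dx.
Qed.

Lemma trim_d3_inj x : d3 T x = 0 -> x = 0.
Proof.
case: x => f g [] df dg.
have f0 : f = 0 by apply: d3_inj_resolves (tF_res S) _ df.
rewrite f0; congr pair; apply: dsumP => i.
apply: etrans (d3_inj_resolves (x := dsum_at g i) (tG_res i) _) _;
  last by rewrite dsumE.
have := congr1 (fun x => dsum_at x i) dg.
by rewrite dsumE f0 raddf0 add0r => ->; rewrite dsumE.
Qed.

Lemma trim_exact2 x : d2 T x = 0 -> exists y, d3 T y = x.
Proof.
case: x => f g [] df dg.
have dgi i : d2 (G i) (dsum_at g i) = tq1 i f.
  have := congr1 (fun x => dsum_at x i) dg; rewrite dsumE /= => e.
  by apply/eqP; rewrite -subr_eq0 addrC e dsumE.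
have dF : d2 F f = 0.
  rewrite td2_split df raddf0 add0r big1 // => i _.
  by rewrite -tq1P -dgi d12 scale0r.
have [f3 f3P] := (tF_res S).2 1%N f dF.
have /fin_all_exists [g3 g3P] i :
    exists g3, d3 (G i) g3 = dsum_at g i - tq2 i f3.
  have := (tG_res i).2 1%N (dsum_at g i - tq2 i f3); apply.
  by rewrite raddfB /= dgi tq2P; move: f3P => /= ->; rewrite subrr.
exists (f3, dsum_of g3); congr pair; first exact: f3P.
by apply: dsumP => i; rewrite !dsumE g3P addrC subrK.
Qed.

Lemma trim1_gen (x : trim1 S) :
  x = inF1 x.1 + \sum_i inG1 (dsum_at x.2 i).
Proof.
case: x => f g; have -> : \sum_i inG1 (dsum_at g i) = (0, g) :> trim1 S.
  apply/eqP; rewrite -pair_eqE /pair_eq /=.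
  rewrite (raddf_sum fst) (raddf_sum snd) /= big1 //= eqxx /=.
  apply/eqP/dsumP => k; rewrite (lin_sum _ _ _ (dsum_at_is_linear k)).
  rewrite (bigD1 k) //= single_at big1 ?addr0 // => i ik.
  by rewrite single_out // eq_sym.
by congr pair; rewrite /= (addr0, add0r).
Qed.

Lemma single_linear (V : 'I_(tn S) -> vectType R) i : linear (@single R S V i).
Proof.
move=> a u v; apply: dsumP => j; rewrite dsum_at_is_linear.
have [->|ji] := eqVneq j i; first by rewrite !single_at.
by rewrite !single_out // scaler0 addr0.
Qed.

Lemma inG1_linear i : linear (@inG1 R S i).
Proof.
by move=> a u v; congr pair; rewrite /= ?scaler0 ?addr0 // -single_linear.
Qed.

Lemma inG2_linear i : linear (@inG2 R S i).
Proof.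
by move=> a u v; congr pair; rewrite /= ?scaler0 ?addr0 // -single_linear.
Qed.

(** Antisymmetry leaves four kinds of pairs of generators of T_1; the pairs from
    one and the same G_1^i are kept apart since the theorem prescribes nothing
    for them. *)
Lemma trim1_bil0 (W : lmodType R) (B : trim1 S -> trim1 S -> W) :
  bilin B -> (forall x y, B y x = - B x y) ->
  (forall f f', B (inF1 f) (inF1 f') = 0) ->
  (forall f i (g : c1 (G i)), B (inF1 f) (inG1 g) = 0) ->
  (forall i (g g' : c1 (G i)), B (inG1 g) (inG1 g') = 0) ->
  (forall i j (g : c1 (G i)) (g' : c1 (G j)), (i < j)%N ->
     B (inG1 g) (inG1 g') = 0) ->
  forall x y, B x y = 0.
Proof.
move=> [hl hr] anti FF FG GG GlG.
have BF f y : B (inF1 f) y = 0.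
  by rewrite (trim1_gen y) (linD (hr _)) FF add0r (lin_sum _ _ _ (hr _)) big1.
have BG i (g : c1 (G i)) y : B (inG1 g) y = 0.
  rewrite (trim1_gen y) (linD (hr _)) anti FG oppr0 add0r.
  rewrite (lin_sum _ _ _ (hr _)).
  rewrite big1 // => j _; have [ij|ji|/val_inj e] := ltngtP i j.
  - exact: GlG.
  - by rewrite anti GlG ?oppr0.
  - by case: _ / e (dsum_at _ _) => g'; exact: GG.
move=> x y; rewrite (trim1_gen x) (linD (hl _)) BF add0r (lin_sum _ _ _ (hl _)).
by rewrite big1.
Qed.

End TrimmingResolution.

(** * The product on the trimming complex *)

Section TrimmingMultiplication.
Variables (R : comNzRingType) (S : trimming_data R) (A : trimming_dg S).

Let F := tF S.
Let G := @tG R S.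
Let T := trimming_complex S.
Let e := @te0 R S.
Let inc : tF1' S -> c1 F := tinc S.
Let q1 := @tq1 R S.
Let m1 i (g : c1 (G i)) : R := d1 (G i) g.
Let lam i : R := d1 F (e i).
Let dF f : R := d1 F (inc f).

Local Notation "x *F y" := (mul11 (dgF A) x y) (at level 40).
Let act1 i k : c1 (G i) -> c1 (G k) -> c2 (G k) := act11 (dgact A i k).
Let act2 i k : c2 (G i) -> c1 (G k) -> c3 (G k) := act21 (dgact A i k).
Let aug1 i k : c1 (G i) -> c1 (G k) := unit_act1 (dgact A i k).
Let aug2 i k : c2 (G i) -> c2 (G k) := unit_act2 (dgact A i k).

Lemma aug1_diag i (g : c1 (G i)) : aug1 i g = g.
Proof.
rewrite /aug1 /unit_act1 dgact_diag dmul_1r; exact: (@degcast_id _ (G i) 1).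
Qed.

Lemma aug2_diag i (g : c2 (G i)) : aug2 i g = g.
Proof.
rewrite /aug2 /unit_act2 dgact_diag dmul_1r; exact: (@degcast_id _ (G i) 2).
Qed.

Lemma d2_act1 i k (g : c1 (G i)) (y : c1 (G k)) :
  d2 (G k) (act1 g y) = m1 g *: y - m1 y *: aug1 k g.
Proof. exact: act11_leibniz. Qed.

Lemma d3_act2 i k (g : c2 (G i)) (y : c1 (G k)) :
  d3 (G k) (act2 g y) = act1 (d2 (G i) g) y + m1 y *: aug2 k g.
Proof. exact: act21_leibniz. Qed.

Lemma act1_bilin i k : bilin (@act1 i k).
Proof. exact: act11_bilin. Qed.

Lemma mulF_bilin : bilin (mul11 (dgF A)).
Proof. exact: mul11_bilin. Qed.

(** This lemma and the next two hold by the Leibniz rule in F, which writes d_2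
    of the product in terms of F_1' and the e_k. *)
Lemma q_FF f f' :
  td2' S (inc f *F inc f') = dF f *: f' - dF f' *: f /\
  forall k, m1 (q1 k (inc f *F inc f')) = 0.
Proof.
apply: (@split_d2 _ S _ _ (fun=> 0)); rewrite mul11_leibniz linearB !linearZ /=.
by rewrite big1 ?addr0 // => i _; rewrite scale0r.
Qed.

Lemma q_GF i f :
  td2' S (e i *F inc f) = lam i *: f /\
  forall k, m1 (q1 k (e i *F inc f)) = if k == i then - dF f else 0.
Proof.
apply: (@split_d2 _ S); rewrite mul11_leibniz [tinc S _]linearZ /=.
congr (_ + _).
rewrite (bigD1 i) //= eqxx scaleNr big1 ?addr0 // => k /negPf ->.
by rewrite scale0r.
Qed.

Lemma q_GG i j : i != j ->
  td2' S (e i *F e j) = 0 /\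
  forall k, m1 (q1 k (e i *F e j)) =
    if k == i then - lam j else if k == j then lam i else 0.
Proof.
move=> ij; apply: (@split_d2 _ S); rewrite mul11_leibniz linear0 add0r.
rewrite (bigD1 i) //= eqxx (bigD1 j) 1?eq_sym //= (negPf ij) eqxx big1.
  by rewrite addr0 scaleNr addrC.
by move=> k /andP[/negPf -> /negPf ->]; rewrite scale0r.
Qed.

Lemma trim_ext (V : vectType R) (W : 'I_(tn S) -> vectType R)
    (x y : V * dsum W) :
  x.1 = y.1 -> (forall k, dsum_at x.2 k = dsum_at y.2 k) -> x = y.
Proof. by case: x y => [a b] [c d] /= -> h; congr pair; apply: dsumP. Qed.

Lemma ell1_F f : d1 T (inF1 f) = dF f.
Proof.
rewrite /= /ell1 big1 ?subr0 // => i _ /=.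
by rewrite (lin0 (dsum_at_is_linear i)) raddf0 mul0r.
Qed.

Lemma ell1_G i (g : c1 (G i)) : d1 T (inG1 g) = - (m1 g * lam i).
Proof.
rewrite /= /ell1 /= !raddf0 sub0r; congr (- _).
have := sum_single predT (fun j (g : c1 (G j)) => m1 g * lam j) g.
by apply=> j; rewrite /m1 raddf0 mul0r.
Qed.

Lemma ell2_G i (g : c2 (G i)) : d2 T (inG2 g) = inG1 (d2 (G i) g).
Proof.
apply: trim_ext => [|k]; rewrite /= ?raddf0 // !dsumE raddf0 oppr0 add0r.
have [ki|ki] := eqVneq k i; first by subst k; rewrite !dfwith_in.
by rewrite !dfwith_out 1?eq_sym // raddf0.
Qed.

Definition prodFG i f (g : c1 (G i)) : trim2 S :=
  (m1 g *: (e i *F inc f),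
   @dsum_of R _ (fun k => c2 (G k)) (fun k => act1 g (q1 k (e i *F inc f)))).

Definition prodGG i j (g : c1 (G i)) (g' : c1 (G j)) : trim2 S :=
  ((m1 g * m1 g') *: (e i *F e j),
   @dsum_of R _ (fun k => c2 (G k)) (fun k =>
     if k == i then m1 g' *: act1 g (q1 k (e i *F e j))
     else m1 g *: act1 g' (q1 k (e i *F e j)))).

Lemma prodFG_bilin i : bilin (@prodFG i).
Proof.
have [hl hr] := mulF_bilin.
have qlin k : linear (fun f => q1 k (e i *F inc f)).
  by move=> a u v; rewrite /inc linearP hr /q1 linearP.
split=> y a u v; apply: trim_ext => [|k] /=.
- by rewrite /inc linearP hr scalerDr !scalerA mulrC.
- by rewrite dsum_at_is_linear !dsumE qlin (act1_bilin i k).2.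
- by rewrite /m1 linearP scalerDl scalerA.
- by rewrite dsum_at_is_linear !dsumE (act1_bilin i k).1.
Qed.

Lemma prodGG_bilin i j : bilin (@prodGG i j).
Proof.
split=> y a u v; apply: trim_ext => [|k] /=.
- by rewrite /m1 linearP mulrDl scalerDl -mulrA scalerA.
- rewrite dsum_at_is_linear !dsumE; case: ifP => _.
    by rewrite (act1_bilin i k).1 scalerDr !scalerA mulrC.
  by rewrite /m1 linearP scalerDl scalerA.
- by rewrite /m1 linearP mulrDr scalerDl !scalerA mulrCA.
- rewrite dsum_at_is_linear !dsumE; case: ifP => _.
    by rewrite /m1 linearP scalerDl scalerA.
  by rewrite (act1_bilin j k).1 scalerDr !scalerA mulrC.
Qed.

(** The terms m_1(g) q_1^k cancel for every k; the terms that involve the action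
    of g on 1 survive for k = i only, where they give back g. *)
Lemma prodFG_leibniz i f (g : c1 (G i)) :
  d2 T (prodFG f g) = dF f *: inG1 g - (- (m1 g * lam i)) *: inF1 f.
Proof.
have [tq mq] := q_GF i f; apply: trim_ext => [|k] /=.
  by rewrite linearZ /= tq scalerA scaler0 sub0r scaleNr opprK.
rewrite !dsumE linearZ /= d2_act1 mq addKr.
have [ki|ki] := eqVneq k i.
  by subst k; rewrite aug1_diag dfwith_in scaler0 subr0 scaleNr opprK.
by rewrite dfwith_out 1?eq_sym // scale0r !scaler0 ?subr0 ?oppr0.
Qed.

(** As for [prodFG_leibniz], except that two indices survive. At k = i it is
    g that has to act, since this leaves a multiple of g, and at k = j it is g'.
    At any other k either of them could act. *)
Lemma prodGG_leibniz i j (g : c1 (G i)) (g' : c1 (G j)) : i != j ->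
  d2 T (prodGG g g') =
    (- (m1 g * lam i)) *: inG1 g' - (- (m1 g' * lam j)) *: inG1 g.
Proof.
move=> ij; have [tq mq] := q_GG ij; apply: trim_ext => [|k] /=.
  by rewrite linearZ /= tq !scaler0 subr0.
rewrite !dsumE [tq1 _ _]linearZ /=; have [ki|ki] := eqVneq k i.
  subst k; rewrite dfwith_in dfwith_out 1?eq_sym // [d2 _ _]linearZ /=.
  rewrite d2_act1 mq eqxx.
  rewrite scalerBr !scalerA [m1 g' * m1 g]mulrC addKr aug1_diag.
  by rewrite scaler0 add0r mulrN.
rewrite [d2 _ _]linearZ /= d2_act1 mq (negPf ki) scalerBr scalerA addKr.
have [kj|kj] := eqVneq k j.
  subst k; rewrite dfwith_in dfwith_out // aug1_diag scaler0 subr0.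
  by rewrite scalerA scaleNr.
by rewrite !dfwith_out 1?eq_sym // scale0r !scaler0 subr0 oppr0.
Qed.

(* the components in G_2^k of the products of two elements of F_1' *)
Variable beta : forall k, tF1' S -> tF1' S -> c2 (G k).
Hypothesis beta_bilin : forall k, bilin (beta k).
Hypothesis beta_alt : forall k f, beta k f f = 0.
Hypothesis beta_lift : forall k f f',
  d2 (G k) (beta k f f') = q1 k (inc f *F inc f').

Definition prodFF f f' : trim2 S :=
  (inc f *F inc f', @dsum_of R _ (fun k => c2 (G k)) (fun k => beta k f f')).

(** The Leibniz rule asks for an element with boundary
    - d_1(e_i) (m_1(g) g' - m_1(g') g), and the second factor is the boundary of
    the product of g and g' in G^i. *)
Definition prodGG_diag i (g g' : c1 (G i)) : trim2 S :=
  inG2 (- lam i *: mul11 (dgG A i) g g').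

Lemma prodFF_bilin : bilin prodFF.
Proof.
apply: bilin_pair; last exact: bilin_dsum.
apply: (bilin_comp (f := inc) (g := inc)); [exact: linearP|exact: linearP|].
exact: mulF_bilin.
Qed.

Lemma prodGG_diag_bilin i : bilin (@prodGG_diag i).
Proof.
by apply: bilin_lcomp (@inG2_linear _ _ _) _; exact/bilin_scale/mul11_bilin.
Qed.

Lemma prodFF_leibniz f f' :
  d2 T (prodFF f f') = dF f *: inF1 f' - dF f' *: inF1 f.
Proof.
have [tq mq] := q_FF f f'; apply: trim_ext => [|k] //=.
by rewrite !dsumE beta_lift addNr !scaler0 subr0.
Qed.

Lemma prodGG_diag_leibniz i (g g' : c1 (G i)) :
  d2 T (prodGG_diag g g') =
    (- (m1 g * lam i)) *: inG1 g' - (- (m1 g' * lam i)) *: inG1 g.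
Proof.
rewrite ell2_G linearZ /= mul11_leibniz -!(linZ (@inG1_linear _ _ _)).
rewrite -(linB (@inG1_linear _ _ _)) scalerBr !scalerA.
by congr (inG1 (_ *: _ - _ *: _)); rewrite mulNr mulrC.
Qed.

(** One of each two opposite products of different summands. Antisymmetrizing it
    in [trim11] yields an alternating map whatever the characteristic is. *)
Definition trim_cross (x y : trim1 S) : trim2 S :=
  \sum_i prodFG x.1 (dsum_at y.2 i) +
  \sum_(i < tn S) \sum_(j < tn S | (i < j)%N)
    prodGG (dsum_at x.2 i) (dsum_at y.2 j).

Definition trim11 (x y : trim1 S) : trim2 S :=
  prodFF x.1 y.1 + \sum_i prodGG_diag (dsum_at x.2 i) (dsum_at y.2 i) +
  (trim_cross x y - trim_cross y x).

Lemma trim_cross_bilin : bilin trim_cross.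
Proof.
have lin1 : linear (fun x : trim1 S => x.1) by [].
have lin2 i : linear (fun x : trim1 S => dsum_at x.2 i).
  by move=> a u v; rewrite -dsum_at_is_linear.
apply: bilinD; apply: bilin_sum => i.
  exact: (bilin_comp lin1 (lin2 i) (prodFG_bilin i)).
apply: bilin_sum => j.
exact: (bilin_comp (lin2 i) (lin2 j) (prodGG_bilin i j)).
Qed.

Lemma trim11_bilin : bilin trim11.
Proof.
have lin1 : linear (fun x : trim1 S => x.1) by [].
have lin2 i : linear (fun x : trim1 S => dsum_at x.2 i).
  by move=> a u v; rewrite -dsum_at_is_linear.
apply: bilinD; last exact: (bilinB trim_cross_bilin (bilinC trim_cross_bilin)).
apply: bilinD; first exact: (bilin_comp lin1 lin1 prodFF_bilin).
apply: bilin_sum => i.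
exact: (bilin_comp (lin2 i) (lin2 i) (prodGG_diag_bilin i)).
Qed.

Lemma trim11_alt x : trim11 x x = 0.
Proof.
rewrite /trim11 subrr addr0 big1 ?addr0 => [|i _].
  by apply: trim_ext => [|k] /=; rewrite ?mul11_alt // !dsumE beta_alt.
by rewrite /prodGG_diag mul11_alt scaler0 (lin0 (@inG2_linear _ _ _)).
Qed.

Lemma dsum_at0 (V : 'I_(tn S) -> vectType R) i : dsum_at (0 : dsum V) i = 0.
Proof. exact: lin0 (dsum_at_is_linear i). Qed.

Lemma prodFG0 i f : prodFG f (0 : c1 (G i)) = 0.
Proof. exact: lin0 ((prodFG_bilin i).2 f). Qed.

Lemma prod0G i (g : c1 (G i)) : prodFG 0 g = 0.
Proof. exact: lin0 ((prodFG_bilin i).1 g). Qed.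

Lemma prodGG0 i j (g : c1 (G i)) : prodGG g (0 : c1 (G j)) = 0.
Proof. exact: lin0 ((prodGG_bilin i j).2 g). Qed.

Lemma prodGG0l i j (g : c1 (G j)) : prodGG (0 : c1 (G i)) g = 0.
Proof. exact: lin0 ((prodGG_bilin i j).1 g). Qed.

Lemma trim_cross_F f y :
  trim_cross (inF1 f) y = \sum_i prodFG f (dsum_at y.2 i).
Proof.
rewrite /trim_cross [X in _ + X]big1 ?addr0 // => i _.
by rewrite big1 // => j _; rewrite dsum_at0 prodGG0l.
Qed.

Lemma trim_cross_to_F x f : trim_cross x (inF1 f) = 0.
Proof.
rewrite /trim_cross big1 ?add0r => [|i _]; last by rewrite dsum_at0 prodFG0.
by rewrite big1 // => i _; rewrite big1 // => j _; rewrite dsum_at0 prodGG0.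
Qed.

Lemma trim_cross_G i j (g : c1 (G i)) (g' : c1 (G j)) :
  trim_cross (inG1 g) (inG1 g') = if (i < j)%N then prodGG g g' else 0.
Proof.
rewrite /trim_cross big1 ?add0r => [|k _]; last exact: prod0G.
rewrite (sum_single predT
  (fun k (g : c1 (G k)) =>
     \sum_(l < tn S | (k < l)%N) prodGG g (dsum_at (inG1 g').2 l)) g) /=.
  rewrite (sum_single (fun l : 'I_(tn S) => i < l)%N
    (fun l (g' : c1 (G l)) => prodGG g g') g') //.
  by move=> l; exact: prodGG0.
by move=> k; rewrite big1 // => l _; exact: prodGG0l.
Qed.

Lemma trim11_FF f f' : trim11 (inF1 f) (inF1 f') = prodFF f f'.
Proof.
rewrite /trim11 !trim_cross_to_F subrr addr0 big1 ?addr0 // => i _.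
by rewrite dsum_at0; exact: lin0 ((prodGG_diag_bilin i).2 0).
Qed.

Lemma trim11_FG i f (g : c1 (G i)) : trim11 (inF1 f) (inG1 g) = prodFG f g.
Proof.
rewrite /trim11 trim_cross_to_F subr0 trim_cross_F.
rewrite (lin0 (prodFF_bilin.2 f)) big1 => [|k _]; last first.
  by rewrite dsum_at0; exact: lin0 ((prodGG_diag_bilin k).1 _).
rewrite !add0r (sum_single predT (fun k (g : c1 (G k)) => prodFG f g) g) //.
by move=> k; exact: prodFG0.
Qed.

Lemma trim11_GG i j (g : c1 (G i)) (g' : c1 (G j)) : (i < j)%N ->
  trim11 (inG1 g) (inG1 g') = prodGG g g'.
Proof.
move=> ij; rewrite /trim11 !trim_cross_G ij ltnNge (ltnW ij) subr0.
rewrite (lin0 (prodFF_bilin.2 _)) big1 ?add0r // => k _.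
have [ki|ki] := eqVneq k i.
  rewrite [dsum_at (inG1 g').2 k]single_out; last by rewrite ki neq_ltn ij.
  exact: lin0 ((prodGG_diag_bilin k).2 _).
by rewrite single_out //; exact: lin0 ((prodGG_diag_bilin k).1 _).
Qed.

Lemma trim11_GG_diag i (g g' : c1 (G i)) :
  trim11 (inG1 g) (inG1 g') = prodGG_diag g g'.
Proof.
rewrite /trim11 !trim_cross_G ltnn subrr addr0.
rewrite (lin0 (prodFF_bilin.2 _)) add0r.
rewrite (sum_single predT
  (fun k (h : c1 (G k)) => prodGG_diag h (dsum_at (inG1 g').2 k)) g).
  by rewrite single_at.
by move=> k; exact: lin0 ((prodGG_diag_bilin k).1 _).
Qed.

Lemma trim11_leibniz x y :
  d2 T (trim11 x y) = (d1 T x : R) *: y - (d1 T y : R) *: x.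
Proof.
apply/eqP; rewrite -subr_eq0; apply/eqP; move: x y.
apply: trim1_bil0 => [|x y|f f'|f i g|i g g'|i j g g' ij].
- apply: bilinB.
    exact: (bilin_lcomp (@linearP _ _ _ _ (d2 T)) trim11_bilin).
  have b : bilin (fun x y : trim1 S => (d1 T x : R) *: y).
    by apply: bilin_lscale => //; exact: linearP.
  exact: (bilinB b (bilinC b)).
- rewrite (alt_anti trim11_bilin trim11_alt) raddfN.
  by rewrite [RHS]opprD opprK [in LHS]opprB.
- by rewrite trim11_FF prodFF_leibniz !ell1_F subrr.
- by rewrite trim11_FG prodFG_leibniz ell1_F ell1_G subrr.
- by rewrite trim11_GG_diag prodGG_diag_leibniz !ell1_G subrr.
- by rewrite trim11_GG // prodGG_leibniz ?neq_ltn ?ij // !ell1_G subrr.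
Qed.

(** The first two product formulas hold by construction of [trim11], the last two
    because d_3 is injective on T_3. *)
Lemma trim_dg_algebra : exists D : dg_algebra3 T,
  extends_products A D /\ forall x y, mul11 D x y = trim11 x y.
Proof.
have [D DP] := @extend_product R T trim11 trim11_bilin trim11_alt trim11_leibniz
                 (@trim_d3_inj _ S) (@trim_exact2 _ S).
have d3I x y : d3 T x = d3 T y -> x = y.
  move=> dxy; apply/eqP; rewrite -subr_eq0; apply/eqP/trim_d3_inj.
  by rewrite raddfB /= -/T dxy subrr.
exists D; split=> //; split.
- by move=> f i g; rewrite DP trim11_FG.
- move=> i j g g' ij; rewrite DP trim11_GG //; apply: trim_ext => // k.
  by rewrite !dsumE; do 2?[case: ifP].
(* F_1' x G_2^i: only k = i sees the term d_1(f) g of the Leibniz rule *)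
- move=> f i g; apply: d3I; rewrite mul12_leibniz ell2_G DP trim11_FG ell1_F.
  have [tq mq] := q_GF i f; apply/esym/trim_ext => [|k] /=.
    by rewrite linear0 /m1 d12 scaler0 scale0r subr0.
  rewrite !dsumE linear0 add0r linearN /= d3_act2 mq.
  have [ki|ki] := eqVneq k i.
    by subst k; rewrite dfwith_in aug2_diag scaleNr opprB.
  by rewrite dfwith_out 1?eq_sym // scale0r scaler0 addr0 sub0r.
(* G_1^i x G_2^j: as m_1 m_2 = 0, only the components with coefficient m_1(g)
   survive in the product of g with the boundary of g' *)
move=> i j g g' ij; apply: d3I; rewrite mul12_leibniz ell2_G DP ell1_G.
have [tq mq] := q_GG ij; apply: esym.
have [lt_ij|le_ji] := ltnP i j.
  rewrite trim11_GG //; apply: trim_ext => [|k] /=.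
    by rewrite linear0 /m1 d12 mulr0 scaler0 scale0r subr0.
  rewrite !dsumE linear0 add0r; have [ki|ki] /= := eqVneq k i.
    rewrite linear0 dfwith_out; last by rewrite ki eq_sym.
    by rewrite scaler0 /m1 d12 scale0r subr0.
  rewrite linearN [d3 _ _]linearZ /= d3_act2 mq (negPf ki).
  have [kj|kj] := eqVneq k j.
    subst k; rewrite dfwith_in aug2_diag scalerDr opprD scalerA.
    by rewrite scaleNr addrC.
  by rewrite dfwith_out 1?eq_sym // scale0r scaler0 addr0 sub0r.
(* for j < i the product in degree two is known for the opposite order only *)
have lt_ji : (j < i)%N by rewrite ltn_neqAle le_ji andbT eq_sym.
rewrite (alt_anti trim11_bilin trim11_alt) trim11_GG //.
apply: trim_ext => [|k] /=.
  by rewrite linear0 /m1 d12 mul0r scaler0 scale0r opprK addr0.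
rewrite !dsumE linear0 add0r; have [kj|kj] /= := eqVneq k j.
  subst k; rewrite linearN [d3 _ _]linearZ /= d3_act2 mq eq_sym (negPf ij).
  rewrite eqxx dfwith_in aug2_diag.
  rewrite [e j *F e i](alt_anti mulF_bilin (mul11_alt (dgF A))).
  rewrite [q1 j _]linearN /= (linN ((act1_bilin j j).2 _)) scalerN opprK.
  by rewrite scalerDr opprD scalerA scaleNr addrC.
by rewrite linear0 dfwith_out 1?eq_sym // scaler0 /m1 d12 scale0r opprK addr0.
Qed.

End TrimmingMultiplication.

(** * Alternating forms on a free module *)

Section Coordinates.
Variables (R : comNzRingType) (V : vectType R) (n : nat) (b : 'I_n -> V).
Hypothesis bP : bijective (fun c : {ffun 'I_n -> R} => \sum_i c i *: b i).

Fact coord_ex v : exists c : {ffun 'I_n -> R}, \sum_i c i *: b i == v.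
Proof. by case: bP => c _ cK; exists (c v); apply/eqP/cK. Qed.

Definition bcoord i v : R := xchoose (coord_ex v) i.

Lemma bcoordK v : v = \sum_i bcoord i v *: b i.
Proof. exact/esym/eqP/(xchooseP (coord_ex v)). Qed.

Lemma bcoord_sum (c : 'I_n -> R) i : bcoord i (\sum_j c j *: b j) = c i.
Proof.
have h : \sum_j [ffun j => c j] j *: b j = \sum_j c j *: b j.
  by apply: eq_bigr => j _; rewrite ffunE.
have := eqP (xchooseP (coord_ex (\sum_j c j *: b j))).
by rewrite -[in RHS]h => /(bij_inj bP) /ffunP/(_ i); rewrite ffunE.
Qed.

Lemma bcoordP i a u v : bcoord i (a *: u + v) = a * bcoord i u + bcoord i v.
Proof.
rewrite {1}(bcoordK u) {1}(bcoordK v) scaler_sumr -big_split /=.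
by under eq_bigr do rewrite scalerA -scalerDl; rewrite bcoord_sum.
Qed.

Definition alt_form (W : lmodType R) (s : 'I_n -> 'I_n -> W) x y : W :=
  \sum_(i < n) \sum_(j < n | (i < j)%N)
    (bcoord i x * bcoord j y - bcoord i y * bcoord j x) *: s i j.

Lemma alt_form_bilin (W : lmodType R) (s : 'I_n -> 'I_n -> W) :
  bilin (alt_form s).
Proof.
apply: bilin_sum => i; apply: bilin_sum => j.
by split=> y a u v; rewrite !bcoordP scalerA -scalerDl; congr (_ *: _); ring.
Qed.

Lemma alt_form_alt (W : lmodType R) (s : 'I_n -> 'I_n -> W) x :
  alt_form s x x = 0.
Proof.
rewrite /alt_form big1 // => i _; rewrite big1 // => j _.
by rewrite subrr scale0r.
Qed.

(** Expanding along the basis, the diagonal terms vanish, and the terms with j < i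
    turn into those with i < j on exchanging i and j, up to the sign of B. *)
Lemma alt_formP (W : lmodType R) (B : V -> V -> W) :
  bilin B -> (forall x, B x x = 0) ->
  forall x y, B x y = alt_form (fun i j => B (b i) (b j)) x y.
Proof.
move=> hB alt x y; have [hl hr] := hB; have anti := alt_anti hB alt.
rewrite {1}(bcoordK x) (lin_sum _ _ _ (hl _)).
under eq_bigr => i _.
  rewrite (linZ (hl _)) {1}(bcoordK y) (lin_sum _ _ _ (hr _)) scaler_sumr.
  under eq_bigr do rewrite (linZ (hr _)) scalerA.
  rewrite (bigID (fun j : 'I_n => i < j)%N) /= [X in _ + X](bigD1 i) ?ltnn //=.
  rewrite alt scaler0 add0r.
  over.
rewrite big_split /= [X in _ + X](exchange_big_dep xpredT) //= -big_split.
apply: eq_bigr => i _ /=.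
rewrite [X in _ + X](eq_bigl (fun j : 'I_n => i < j)%N); last first.
  by move=> j; rewrite -leqNgt andbC -val_eqE -ltn_neqAle.
rewrite -big_split; apply: eq_bigr => j _ /=.
by rewrite scalerBl [B (b j) _]anti scalerN mulrC [X in _ - X *: _]mulrC.
Qed.

Lemma alt_form_lift (U W : lmodType R) (m : U -> W) s (B : V -> V -> W) :
  linear m -> bilin B -> (forall x, B x x = 0) ->
  (forall i j, m (s i j) = B (b i) (b j)) ->
  forall x y, m (alt_form s x y) = B x y.
Proof.
move=> hm hB alt ms x y.
rewrite (alt_formP hB alt) /alt_form (lin_sum _ _ _ hm).
apply: eq_bigr => i _; rewrite (lin_sum _ _ _ hm); apply: eq_bigr => j _.
by rewrite (linZ hm) ms.
Qed.

End Coordinates.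

Section VectorBasis.

Import VectorInternalTheory.

Lemma vect_basis (R : comNzRingType) (V : vectType R) :
  exists n (b : 'I_n -> V),
    bijective (fun c : {ffun 'I_n -> R} => \sum_i c i *: b i).
Proof.
pose N := dim V.
have r2vl : linear (r2v : 'rV[R]_N -> V).
  by move=> a u w; rewrite linearP.
pose b i : V := @r2v _ V (delta_mx 0 i).
exists N, b.
have e (c : {ffun 'I_N -> R}) : \sum_i c i *: b i = @r2v _ V (\row_i c i).
  rewrite [\row_i c i]row_sum_delta (lin_sum _ _ _ r2vl).
  by apply: eq_bigr => i _; rewrite (linZ r2vl) mxE.
exists (fun v => [ffun i => v2r v 0 i]) => [c|v].
  by rewrite e r2vK; apply/ffunP => i; rewrite ffunE mxE.
rewrite e -[RHS]v2rK; congr r2v.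
by apply/rowP => i; rewrite mxE ffunE.
Qed.

End VectorBasis.

(** * Homogeneous elements over a polynomial ring *)

Local Notation deg g i := (@gdeg _ _ _ g i).
Local Notation bas g i := (@gbasis _ _ _ g i).

Section Homogeneous.
Variables (K : fieldType) (n : nat).
Let R : comNzRingType := {mpoly K[n]}.
Implicit Types (r s : R) (d e : int).

Lemma ring_homog0 d : ring_homog d (0 : R).
Proof. by case: d => m //=; exact: rpred0. Qed.

Lemma ring_homog1 : ring_homog 0 (1 : R).
Proof. exact: dhomog1. Qed.

Lemma ring_homogD d r s :
  ring_homog d r -> ring_homog d s -> ring_homog d (r + s).
Proof. by case: d => m /=; [exact: rpredD | move=> -> ->; rewrite addr0]. Qed.

Lemma ring_homogN d r : ring_homog d r -> ring_homog d (- r).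
Proof. by case: d => m /=; [rewrite rpredN | move=> ->; rewrite oppr0]. Qed.

Lemma ring_homogM d e r s :
  ring_homog d r -> ring_homog e s -> ring_homog (d + e) (r * s).
Proof.
case: d => [d|d] /= hr; last by rewrite hr mul0r => _; exact: ring_homog0.
case: e => [e|e] /= hs; last by rewrite hs mulr0; exact: ring_homog0.
exact: dhomogM.
Qed.

Definition ring_part d r : R :=
  match d with Posz m => pihomog mdeg m r | Negz _ => 0 end.

Lemma ring_part_homog d r : ring_homog d (ring_part d r).
Proof. by case: d => m //=; exact: pihomogP. Qed.

Lemma ring_partD d r s : ring_part d (r + s) = ring_part d r + ring_part d s.
Proof. by case: d => m /=; rewrite ?pihomogD ?addr0. Qed.

Lemma ring_part0 d : ring_part d 0 = 0.
Proof. by case: d => m //=; exact: pihomog0. Qed.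

Lemma ring_part_sum d I (l : seq I) (F : I -> R) :
  ring_part d (\sum_(i <- l) F i) = \sum_(i <- l) ring_part d (F i).
Proof. exact: (big_morph _ (ring_partD d) (ring_part0 d)). Qed.

Lemma ring_part_of_homog d e r :
  ring_homog e r -> ring_part d r = if d == e then r else 0.
Proof.
case: e => [e|e] /= hr; last by rewrite hr ring_part0 if_same.
case: d => [d|d] //=; rewrite eqz_nat; case: eqP => [->|de].
  exact: pihomog_dE.
by apply: (pihomog_ne0 (d := e)) hr; rewrite eq_sym; apply/eqP.
Qed.

(** Multiplication by a homogeneous element shifts homogeneous parts. *)
Lemma ring_partM d e r s :
  ring_homog e s -> ring_part d (r * s) = ring_part (d - e) r * s.
Proof.
move=> hs; have dec : r = \sum_(c < msize r) pihomog mdeg c r.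
  exact: (pihomog_partitionE (mf := mdeg)) (leqnn _).
rewrite [in LHS]dec [in RHS]dec mulr_suml !ring_part_sum mulr_suml.
apply: eq_bigr => c _.
have hc : ring_homog c%:Z (pihomog mdeg c r) by exact: pihomogP.
rewrite (ring_part_of_homog _ (ring_homogM hc hs)) (ring_part_of_homog _ hc).
by rewrite subr_eq; case: ifP; rewrite ?mul0r.
Qed.

Section Module.
Variables (V : vectType R) (g : grading V).

Let co := bcoord (gbasisP g).

Lemma homog_coordP d v :
  is_homog g d v <-> forall i, ring_homog (d - deg g i) (co i v).
Proof.
split=> [[c -> hc] i|hc]; first by rewrite /co bcoord_sum.
by exists (fun i => co i v); first exact: bcoordK.
Qed.

Lemma homog0 d : is_homog g d 0.
Proof.
exists (fun=> 0) => [|i]; last exact: ring_homog0.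
by rewrite big1 // => i _; rewrite scale0r.
Qed.

Lemma homogD d u v : is_homog g d u -> is_homog g d v -> is_homog g d (u + v).
Proof.
move=> [c -> hc] [c' -> hc']; exists (fun i => c i + c' i) => [|i].
  by rewrite -big_split; apply: eq_bigr => i _; rewrite scalerDl.
exact: ring_homogD.
Qed.

Lemma homogZ d e r v :
  ring_homog e r -> is_homog g d v -> is_homog g (e + d) (r *: v).
Proof.
move=> hr [c -> hc]; exists (fun i => r * c i) => [|i].
  by rewrite scaler_sumr; apply: eq_bigr => i _; rewrite scalerA.
by rewrite -addrA; apply: ring_homogM.
Qed.

Lemma homogN d v : is_homog g d v -> is_homog g d (- v).
Proof.
move=> hv; rewrite -scaleN1r -[d]add0r; apply: homogZ hv.
exact/ring_homogN/ring_homog1.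
Qed.

Lemma homog_sum d I (l : seq I) (P : pred I) (F : I -> V) :
  (forall i, P i -> is_homog g d (F i)) ->
  is_homog g d (\sum_(i <- l | P i) F i).
Proof.
by move=> h; apply: big_ind => //; [exact: homog0 | exact: homogD].
Qed.

Lemma homog_basis i : is_homog g (deg g i) (bas g i).
Proof.
exists (fun j => (j == i)%:R) => [|j].
  rewrite (bigD1 i) //= eqxx scale1r big1 ?addr0 // => j /negPf ->.
  by rewrite scale0r.
case: eqP => [->|_]; last exact: ring_homog0.
by rewrite subrr; exact: ring_homog1.
Qed.

End Module.

(** The part of degree d of a preimage is a preimage: the matrix of a graded map
    has homogeneous entries, so the map commutes with taking homogeneous parts
    ([ring_partM]). *)
Lemma homog_lift (V W : vectType R) (gV : grading V) (gW : grading W)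
    (f : {linear V -> W}) d v :
  (forall e x, is_homog gV e x -> is_homog gW e (f x)) ->
  is_homog gW d (f v) -> exists2 v', is_homog gV d v' & f v' = f v.
Proof.
move=> hf hv; pose co := bcoord (gbasisP gV).
pose co' := bcoord (gbasisP gW).
exists (\sum_i ring_part (d - deg gV i) (co i v) *: bas gV i).
  exists (fun i => ring_part (d - deg gV i) (co i v)) => // i.
  exact: ring_part_homog.
have fl : linear f by exact: linearP.
have co'_lin j : linear (co' j : W -> R^o) by move=> a u w; exact: bcoordP.
have fsum (c : 'I_(grank gV) -> R) j :
    co' j (f (\sum_i c i *: bas gV i)) = \sum_i c i * co' j (f (bas gV i)).
  rewrite raddf_sum (lin_sum _ _ _ (co'_lin j)); apply: eq_bigr => i _.
  exact: etrans (congr1 (co' j) (linZ fl (c i) (bas gV i)))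
                (linZ (co'_lin j) _ _).
rewrite [LHS](bcoordK (gbasisP gW)) [RHS](bcoordK (gbasisP gW)).
apply: eq_bigr => j _; congr (_ *: _).
rewrite -/co' fsum.
have <- : ring_part (d - deg gW j) (co' j (f v)) = co' j (f v).
  have /homog_coordP/(_ j) h := hv.
  by rewrite (ring_part_of_homog _ h) eqxx.
rewrite {2}(bcoordK (gbasisP gV) v) fsum ring_part_sum.
apply: eq_bigr => i _.
have /homog_coordP/(_ j) h := hf _ _ (homog_basis i).
by rewrite (ring_partM _ _ h); congr (ring_part _ _ * _); ring.
Qed.

Lemma homog_reflect (V W : vectType R) (gV : grading V) (gW : grading W)
    (f : {linear V -> W}) d v :
  (forall e x, is_homog gV e x -> is_homog gW e (f x)) ->
  (forall x, f x = 0 -> x = 0) ->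
  is_homog gW d (f v) -> is_homog gV d v.
Proof.
move=> hf f_inj /(homog_lift hf) [v' hv' e].
suff -> : v = v' by [].
by apply/eqP; rewrite -subr_eq0; apply/eqP/f_inj; rewrite raddfB /= e subrr.
Qed.

Lemma alt_form_homog (V W : vectType R) (gV : grading V) (gW : grading W)
    (eps : int) (s : 'I_(grank gV) -> 'I_(grank gV) -> W) d d' x y :
  (forall i j, is_homog gW (deg gV i + deg gV j - eps) (s i j)) ->
  is_homog gV d x -> is_homog gV d' y ->
  is_homog gW (d + d' - eps) (alt_form (gbasisP gV) s x y).
Proof.
move=> hs /homog_coordP hx /homog_coordP hy.
apply: homog_sum => i _; apply: homog_sum => j _.
have -> : d + d' - eps =
    (d - deg gV i + (d' - deg gV j)) + (deg gV i + deg gV j - eps) by ring.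
apply: homogZ (hs i j); apply: ring_homogD; first exact: ring_homogM.
apply: ring_homogN.
have -> : d - deg gV i + (d' - deg gV j) = d' - deg gV i + (d - deg gV j).
  by ring.
exact: ring_homogM.
Qed.

End Homogeneous.

(** * Algebra structures on the trimming complex *)

(** The element q_1^k(f f') is a cycle of G^k by [q_FF], and G^k is exact in
    degree one. *)
Lemma exists_lift_FF (R : comNzRingType) (S : trimming_data R)
    (A : trimming_dg S) k f f' :
  exists u, d2 (tG k) u = tq1 k (mul11 (dgF A) (tinc S f) (tinc S f')).
Proof.
have [_ mq] := q_FF A f f'.
exact: (tG_res k).2 0%N _ (mq k).
Qed.

Section FromBasis.
Variables (R : comNzRingType) (S : trimming_data R) (A : trimming_dg S).
Variables (n : nat) (b : 'I_n -> tF1' S).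
Hypothesis bP : bijective (fun c : {ffun 'I_n -> R} => \sum_i c i *: b i).
Variable s : forall k, 'I_n -> 'I_n -> c2 (@tG R S k).
Hypothesis sP : forall k i j,
  d2 (tG k) (s k i j) = tq1 k (mul11 (dgF A) (tinc S (b i)) (tinc S (b j))).

(** The preimages of q_1^k of the products of basis vectors of F_1' are left
    free here, so that the graded case can choose homogeneous ones. *)
Lemma trim_dg_of_basis :
  exists D : dg_algebra3 (trimming_complex S), extends_products A D /\
    forall x y, mul11 D x y = trim11 A (fun k => alt_form bP (s k)) x y.
Proof.
apply: trim_dg_algebra => [k|k f|k f f']; first exact: alt_form_bilin.
  exact: alt_form_alt.
apply: (@alt_form_lift _ _ _ _ bP _ _ (d2 (tG k)) (s k)
  (fun f f' => tq1 k (mul11 (dgF A) (tinc S f) (tinc S f')))) => //.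
- exact: linearP.
- apply: bilin_lcomp; first exact: linearP.
  by apply: bilin_comp (mul11_bilin _); exact: linearP.
- by move=> f0; rewrite mul11_alt linear0.
- exact: sP.
Qed.

End FromBasis.

Lemma trim_dg_exists (R : comNzRingType) (S : trimming_data R)
    (A : trimming_dg S) :
  exists D : dg_algebra3 (trimming_complex S), extends_products A D.
Proof.
have [n [b bP]] := vect_basis (tF1' S).
have /fin_all_exists [s sP] k : exists s : {ffun 'I_n * 'I_n -> c2 (@tG R S k)},
    forall p, d2 (tG k) (s p) =
      tq1 k (mul11 (dgF A) (tinc S (b p.1)) (tinc S (b p.2))).
  have /fin_all_exists [s sP] (p : 'I_n * 'I_n) :=
    exists_lift_FF A k (b p.1) (b p.2).
  by exists (finfun s) => p; rewrite ffunE.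
have [|D [DP _]] := @trim_dg_of_basis R S A n b bP (fun k i j => s k (i, j)).
  by move=> k i j; exact: sP.
by exists D.
Qed.

(** * Homogeneity of the products *)

Section GradedTrimming.
Variables (K : fieldType) (n : nat) (S : trimming_data {mpoly K[n]}).
Variables (A : trimming_dg S) (g : graded_trimming A).

Let R : comNzRingType := {mpoly K[n]}.
Let T := trimming_complex S.
Let F := tF S.
Let G := @tG _ S.
Let eps := gr_eps g.

Section Sums.
Variables (V : vectType R) (W : 'I_(tn S) -> vectType R).
Variables (gV : grading V) (gW : forall i, grading (W i)).

(** The summand with index i is shifted by the degree of e_i, as in
    [trim_homog], which this is in degrees one to three. *)
Definition sum_homog d (x : V * dsum W) :=
  is_homog gV d x.1 /\ forall i, is_homog (gW i) (d - eps i) (dsum_at x.2 i).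

Lemma sum_homog0 d : sum_homog d 0.
Proof. by split=> [|i]; rewrite ?dsum_at0; exact: homog0. Qed.

Lemma sum_homogD d x y : sum_homog d x -> sum_homog d y -> sum_homog d (x + y).
Proof.
move=> [x1 x2] [y1 y2]; split=> [|i]; first exact: homogD.
by rewrite (linD (dsum_at_is_linear i)); exact: homogD.
Qed.

Lemma sum_homogZ d e (r : R) x :
  ring_homog e r -> sum_homog d x -> sum_homog (e + d) (r *: x).
Proof.
move=> hr [x1 x2]; split=> [|i]; first exact: homogZ.
by rewrite (linZ (dsum_at_is_linear i)) -addrA; exact: homogZ.
Qed.

Lemma sum_homogN d x : sum_homog d x -> sum_homog d (- x).
Proof.
move=> [x1 x2]; split=> [|i]; first exact: homogN.
by rewrite (linN (dsum_at_is_linear i)); exact: homogN.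
Qed.

Lemma sum_homog_sum d I (l : seq I) (P : pred I) (f : I -> V * dsum W) :
  (forall i, P i -> sum_homog d (f i)) -> sum_homog d (\sum_(i <- l | P i) f i).
Proof.
by move=> h; apply: big_ind => //; [exact: sum_homog0 | exact: sum_homogD].
Qed.

End Sums.

Local Notation "x *F y" := (mul11 (dgF A) x y) (at level 40).

Lemma mulF_homog d d' x y : is_homog (gr1 (grF g)) d x ->
  is_homog (gr1 (grF g)) d' y -> is_homog (gr2 (grF g)) (d + d') (x *F y).
Proof. exact: (@gr_dgF _ _ _ _ g 1 1 d d' x y)%N. Qed.

Lemma act1_homog i j d d' (x : c1 (G i)) (y : c1 (G j)) :
  is_homog (gr1 (grG g i)) d x -> is_homog (gr1 (grG g j)) d' y ->
  is_homog (gr2 (grG g j)) (d + d') (act11 (dgact A i j) x y).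
Proof. exact: (@gr_dgact _ _ _ _ g i j 1 1 d d' x y)%N. Qed.

Lemma te0_homog i : is_homog (gr1 (grF g)) (eps i) (te0 i).
Proof. exact: gr_e0. Qed.

Lemma prodFG_homog i d d' f (x : c1 (G i)) :
  is_homog (grF1' g) d f -> is_homog (gr1 (grG g i)) (d' - eps i) x ->
  sum_homog (gr2 (grF g)) (fun i => gr2 (grG g i)) (d + d') (prodFG A f x).
Proof.
move=> hf hx.
have hw := mulF_homog (te0_homog i) (gr_inc hf).
split=> [|k] /=.
  have -> : d + d' = (d' - eps i) + (eps i + d) by ring.
  exact: homogZ (gr_d1 hx) hw.
rewrite dsumE.
have -> : d + d' - eps k = (d' - eps i) + (eps i + d - eps k) by ring.
exact: act1_homog hx (gr_q1 _ hw).
Qed.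

Lemma prodGG_homog i j d d' (x : c1 (G i)) (y : c1 (G j)) :
  is_homog (gr1 (grG g i)) (d - eps i) x ->
  is_homog (gr1 (grG g j)) (d' - eps j) y ->
  sum_homog (gr2 (grF g)) (fun i => gr2 (grG g i)) (d + d') (prodGG A x y).
Proof.
move=> hx hy.
have hw := mulF_homog (te0_homog i) (te0_homog j).
split=> [|k] /=.
  have -> : d + d' = (d - eps i + (d' - eps j)) + (eps i + eps j) by ring.
  exact: homogZ (ring_homogM (gr_d1 hx) (gr_d1 hy)) hw.
rewrite dsumE; case: ifP => _.
  have -> : d + d' - eps k =
    (d' - eps j) + ((d - eps i) + (eps i + eps j - eps k)) by ring.
  exact: homogZ (gr_d1 hy) (act1_homog hx (gr_q1 _ hw)).
have -> : d + d' - eps k =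
  (d - eps i) + ((d' - eps j) + (eps i + eps j - eps k)) by ring.
exact: homogZ (gr_d1 hx) (act1_homog hy (gr_q1 _ hw)).
Qed.

Lemma prodGG_diag_homog i d d' (x y : c1 (G i)) :
  is_homog (gr1 (grG g i)) (d - eps i) x ->
  is_homog (gr1 (grG g i)) (d' - eps i) y ->
  sum_homog (gr2 (grF g)) (fun i => gr2 (grG g i)) (d + d') (prodGG_diag A x y).
Proof.
move=> hx hy; split=> [|k] /=; first exact: homog0.
have [ki|ki] := eqVneq k i; last by rewrite single_out //; exact: homog0.
subst k; rewrite single_at.
have -> : d + d' - eps i = eps i + ((d - eps i) + (d' - eps i)) by ring.
apply: homogZ; first exact/ring_homogN/(gr_d1 (te0_homog i)).
exact: (@gr_dgG _ _ _ _ g i 1 1 _ _ x y hx hy)%N.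
Qed.

Lemma ell1_homog d (x : trim1 S) :
  trim_homog g (m := 1) d x -> ring_homog d (d1 T x).
Proof.
case=> x1 x2; rewrite /= /ell1; apply: ring_homogD.
  exact: gr_d1 (gr_inc x1).
apply: ring_homogN; apply: (big_ind (ring_homog d)) => [||i _].
- exact: ring_homog0.
- exact: ring_homogD.
have -> : d = (d - eps i) + eps i by ring.
exact: ring_homogM (gr_d1 (x2 i)) (gr_d1 (te0_homog i)).
Qed.

(** The inclusion of F_1' is graded and injective, and the composite of d_2'
    with it is d_2 minus the sum of the d_0^i, all of which are graded. *)
Lemma td2'_homog d x :
  is_homog (gr2 (grF g)) d x -> is_homog (grF1' g) d (td2' S x).
Proof.
move=> hx; apply: (homog_reflect (f := tinc S) (gr_inc (g := g))).
  move=> y y0; suff: (y, 0) = (0, 0) :> tF1' S * {ffun 'I_(tn S) -> R} by case.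
  by apply: (bij_inj (tsplit S)); rewrite /= y0 linear0.
have -> : tinc S (td2' S x) = d2 F x - \sum_i td0 i x.
  by rewrite td2_split addrK.
apply: homogD; first exact: gr_d2.
apply/homogN/homog_sum => i _; rewrite -tq1P.
have -> : d = (d - eps i) + eps i by ring.
exact: homogZ (gr_d1 (gr_q1 i hx)) (te0_homog i).
Qed.

Lemma ell2_homog d (x : trim2 S) :
  trim_homog g (m := 2) d x -> trim_homog g (m := 1) d (d2 T x).
Proof.
case=> x1 x2; split=> [|i] /=; first exact: td2'_homog.
rewrite dsumE; apply: homogD; last exact: gr_d2.
by apply: homogN; exact: gr_q1.
Qed.

(** The component in F_3 is homogeneous because d_3 of F is graded and injective.
    Then so is its image under q_2^i, which can be subtracted from the component
    in G_2^i, and the same argument applies to G^i. *)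
Lemma ell3_reflect_homog d (x : trim3 S) :
  trim_homog g (m := 2) d (d3 T x) -> trim_homog g (m := 3) d x.
Proof.
case=> /= x1 x2.
have h1 : is_homog (gr3 (grF g)) d x.1.
  exact: homog_reflect (gr_d3 (g := _)) (d3_inj_resolves (tF_res S)) x1.
split=> //= i.
apply: homog_reflect (gr_d3 (g := grG g i)) (d3_inj_resolves (tG_res i)) _.
have := x2 i; rewrite dsumE => h.
have -> : d3 (tG i) (dsum_at x.2 i) =
    tq2 i x.1 + d3 (tG i) (dsum_at x.2 i) - tq2 i x.1 by rewrite addrC addKr.
by apply: homogD h _; apply: homogN; exact: gr_q2.
Qed.

Lemma trim_homogZ m d e (r : R) (x : T m) :
  ring_homog e r -> trim_homog g d x -> trim_homog g (e + d) (r *: x).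
Proof.
case: m x => [|[|[|[|m]]]] x //= hr; try exact: sum_homogZ.
exact: ring_homogM.
Qed.

Variable beta : forall k, tF1' S -> tF1' S -> c2 (G k).
Hypothesis beta_homog : forall k d d' f f',
  is_homog (grF1' g) d f -> is_homog (grF1' g) d' f' ->
  is_homog (gr2 (grG g k)) (d + d' - eps k) (beta k f f').

Lemma trim11_homog d d' (x y : trim1 S) :
  trim_homog g (m := 1) d x -> trim_homog g (m := 1) d' y ->
  trim_homog g (m := 2) (d + d') (trim11 A beta x y).
Proof.
pose h2 := sum_homog (gr2 (grF g)) (fun i => gr2 (grG g i)).
have hcross d1 d2 (u v : trim1 S) :
    trim_homog g (m := 1) d1 u -> trim_homog g (m := 1) d2 v ->
    h2 (d1 + d2) (trim_cross A u v).
  move=> [u1 u2] [v1 v2]; apply: sum_homogD; apply: sum_homog_sum => i _.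
    exact: prodFG_homog.
  by apply: sum_homog_sum => j _; exact: prodGG_homog.
move=> hx hy; change (h2 (d + d') (trim11 A beta x y)).
have [x1 x2] := hx; have [y1 y2] := hy.
apply: sum_homogD; last first.
  apply: sum_homogD; first exact: hcross.
  by apply: sum_homogN; rewrite addrC; exact: hcross.
apply: sum_homogD; last first.
  by apply: sum_homog_sum => i _; exact: prodGG_diag_homog.
split=> [|k] /=; first exact: mulF_homog (gr_inc x1) (gr_inc y1).
by rewrite dsumE; exact: beta_homog.
Qed.

(** Products in T_3 are homogeneous because their boundaries are, by
    [ell3_reflect_homog]. *)
Lemma trim_products_homog (D : dg_algebra3 T) :
  (forall x y, mul11 D x y = trim11 A beta x y) ->
  homog_products (trim_homog g) D.
Proof.
move=> DP.
have h0 j d d' (r : R^o) (y : T j) : ring_homog d r -> trim_homog g d' y ->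
    trim_homog g (d + d') (dmul D (i := 0) r y).
  by rewrite dmul_scalar; exact: trim_homogZ.
have hr0 i d d' (x : T i) (r : R^o) : trim_homog g d x -> ring_homog d' r ->
    trim_homog g (d + d') (dmul D (j := 0) x r).
  move=> hx hr; rewrite dmulC muln0 expr0 scale1r addrC.
  have := h0 _ _ _ _ _ hr hx; case: _ / (addnC 0 i).
  by [].
have h12 d d' (x : T 1) (y : T 2) : trim_homog g d x -> trim_homog g d' y ->
    trim_homog g (d + d') (dmul D (i := 1) (j := 2) x y).
  move=> hx hy; apply: ell3_reflect_homog.
  rewrite [X in trim_homog _ _ X](mul12_leibniz D x y) DP.
  apply: (sum_homogD (gV := gr2 (grF g)) (gW := fun i => gr2 (grG g i))).
    exact: sum_homogZ (ell1_homog hx) hy.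
  by apply: sum_homogN; exact: (trim11_homog hx (ell2_homog hy)).
move=> i j d d'.
case: i => [|[|[|[|i]]]] x; case: j => [|[|[|[|j]]]] y hx hy //;
  try exact: h0; try exact: hr0.
- by have := trim11_homog hx hy; rewrite -DP.
- exact: h12.
- have := h12 _ _ _ _ hy hx; rewrite addrC dmulC expr2 mulrNN mulr1 scale1r.
  by rewrite degcast_id.
Qed.

End GradedTrimming.

Lemma trim_dg_graded (K : fieldType) (n : nat) (S : trimming_data {mpoly K[n]})
    (A : trimming_dg S) (g : graded_trimming A) :
  exists D : dg_algebra3 (trimming_complex S),
    extends_products A D /\ homog_products (trim_homog g) D.
Proof.
pose N := grank (grF1' g).
have [s sP s_homog] : exists2 s : forall k, 'I_N -> 'I_N -> c2 (@tG _ S k),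
    forall k i j, d2 (tG k) (s k i j) = tq1 k (mul11 (dgF A)
      (tinc S (bas (grF1' g) i)) (tinc S (bas (grF1' g) j)))
  & forall k i j, is_homog (gr2 (grG g k))
      (deg (grF1' g) i + deg (grF1' g) j - gr_eps g k) (s k i j).
  suff /fin_all_exists2 [s sP s_homog] k :
      exists2 s : {ffun 'I_N * 'I_N -> c2 (@tG _ S k)},
        forall p, d2 (tG k) (s p) = tq1 k (mul11 (dgF A)
          (tinc S (bas (grF1' g) p.1)) (tinc S (bas (grF1' g) p.2)))
      & forall p, is_homog (gr2 (grG g k))
          (deg (grF1' g) p.1 + deg (grF1' g) p.2 - gr_eps g k) (s p).
    exists (fun k i j => s k (i, j)) => k i j; [exact: sP | exact: s_homog].
  suff /fin_all_exists2 [s sP s_homog] (p : 'I_N * 'I_N) :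
      exists2 u, d2 (tG k) u = tq1 k (mul11 (dgF A)
          (tinc S (bas (grF1' g) p.1)) (tinc S (bas (grF1' g) p.2)))
      & is_homog (gr2 (grG g k))
          (deg (grF1' g) p.1 + deg (grF1' g) p.2 - gr_eps g k) u.
    by exists (finfun s) => p; rewrite ffunE.
  have [u uP] := exists_lift_FF A k (bas (grF1' g) p.1) (bas (grF1' g) p.2).
  have [|v hv vP] := homog_lift (v := u) (gr_d2 (g := grG g k))
      (d := deg (grF1' g) p.1 + deg (grF1' g) p.2 - gr_eps g k).
    by rewrite uP; apply/gr_q1/mulF_homog; apply/gr_inc/homog_basis.
  by exists v => //; rewrite vP.
have [D [DP D11]] := trim_dg_of_basis (gbasisP (grF1' g)) sP.
exists D; split=> //; apply: trim_products_homog D11.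
by move=> k d d' f f' hf hf'; apply: alt_form_homog.
Qed.

Theorem proposition3p3 :
  (forall (R : comNzRingType) (S : trimming_data R) (A : trimming_dg S),
     is_regular_local R ->
     exists D : dg_algebra3 (trimming_complex S), extends_products A D) /\
  (forall (k : fieldType) (n : nat) (S : trimming_data {mpoly k[n]})
          (A : trimming_dg S) (g : graded_trimming A),
     exists D : dg_algebra3 (trimming_complex S),
       extends_products A D /\ homog_products (trim_homog g) D).
Proof.
by split=> [R S A _|k n S A g]; [exact: trim_dg_exists | exact: trim_dg_graded].
Qed.
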